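(* Let $N\ge2$, let $\Omega\subsetneq\mathbb{R}^N$ be a domain, let $H_0$ denote minus the Dirichlet Laplacian on $\Omega$, and let $\mu$ denote the quasi-inradius of $\Omega$. Then $$H_0\ \ge\ \frac{N}{4\mu^2}+\frac{4N\lambda_0^2}{D_\infty(\Omega)^2}$$ in the sense of bilinear forms, i.e. $\int_\Omega|\nabla u|^2dx\ge\left(\frac{N}{4\mu^2}+\frac{4N\lambda_0^2}{D_\infty(\Omega)^2}\right)\int_\Omega|u|^2dx$ for all $u$ in the form domain $H_0^1(\Omega)$.
   Context: For $\nu\in S^{N-1}$ and $x\in\Omega$, $\rho_\nu(x)=\inf\{|s|: s\in\mathbb{R},\ x+s\nu\notin\Omega\}$ is the distance from $x$ to $\partial\Omega$ along the line through $x$ in the direction $\nu$; $d\sigma$ is the normalized round measure on $S^{N-1}$. The mean distance function (exponent $2$) is $d_{\Omega,M,2}(x)=\left(N\int_{S^{N-1}}\rho_\nu(x)^{-2}d\sigma(\nu)\right)^{-1/2}$, and the quasi-inradius is $\mu=\sqrt N\,\sup\{d_{\Omega,M,2}(x):x\in\Omega\}$. For $\nu\in S^{N-1}$ and $x'\in\nu^\perp$, let $D_{x',\nu}\in[0,\infty]$ be the supremum of the lengths of the connected components of $\Omega\cap\{x'+s\nu:s\in\mathbb{R}\}$. The essential diameter of $\Omega$ is $D_\infty(\Omega)=\operatorname{ess\,sup}_{\nu\in S^{N-1}}\operatorname{ess\,sup}_{x'\in\nu^\perp}D_{x',\nu}$. $\lambda_0\approx0.940$ is Lamb's constant: the first positive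 zero of $J_0(r)+2rJ_0'(r)$, where $J_0$ is the Bessel function of the first kind of order $0$. Terms with an infinite denominator are read as $0$. *)

(* Defs.v *)
From HB Require Import structures.
From mathcomp Require Import all_boot all_order all_algebra.
From mathcomp Require Import all_classical all_reals all_analysis.
From mathcomp Require Import measurable_realfun ess_sup_inf.

Set Implicit Arguments.
Unset Strict Implicit.
Unset Printing Implicit Defensive.

Import Order.TTheory GRing.Theory Num.Theory.
Import numFieldNormedType.Exports.

Local Open Scope classical_set_scope.
Local Open Scope ring_scope.

(* Row vectors carry the sigma-algebra generated by the coordinates, i.e. the
   Borel sets of R^n.  The library topology on ['rV[R]_n] comes from the sup
   norm, so Euclidean lengths are always written with [enorm] below. *)
Definition rV_display : measure_display -> measure_display.
Proof. exact. Qed.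

Section measurable_rV.
Context {R : realType}.
Variable n : nat.

Let coord : 'I_n -> 'rV[R]_n -> R := fun i x => x 0 i.

Let rV_set0 : g_sigma_preimage coord set0.
Proof. exact: sigma_algebra0. Qed.

Let rV_setC A : g_sigma_preimage coord A -> g_sigma_preimage coord (~` A).
Proof. exact: sigma_algebraC. Qed.

Let rV_bigcup (F : _^nat) : (forall i, g_sigma_preimage coord (F i)) ->
  g_sigma_preimage coord (\bigcup_i (F i)).
Proof. exact: sigma_algebra_bigcup. Qed.

HB.instance Definition _ := @isMeasurable.Build (rV_display default_measure_display)
  'rV[R]_n (g_sigma_preimage coord) rV_set0 rV_setC rV_bigcup.

End measurable_rV.


Section lebesgue_rV.
Context {R : realType}.
Local Open Scope ereal_scope.

Lemma measurable_coord n (i : 'I_n) :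
  measurable_fun [set: 'rV[R]_n] (fun x : 'rV[R]_n => x 0%R i : R).
Proof.
move=> _ Y mY; rewrite setTI; apply: sub_sigma_algebra => /=.
rewrite -bigcup_seq/=; exists i => /=; first by rewrite mem_index_enum.
by exists Y => //; rewrite setTI.
Qed.

Lemma measurable_rVP d (T : measurableType d) n (f : T -> 'rV[R]_n) :
  (forall i, measurable_fun [set: T] (fun x => f x 0%R i : R)) ->
  measurable_fun [set: T] f.
Proof.
move=> mf _ A mA; rewrite setTI; move: A mA.
suff : @measurable _ 'rV[R]_n `<=` image_set_system setT f measurable.
  by move=> h A /h; rewrite /image_set_system/= setTI.
apply: smallest_sub; first exact/sigma_algebra_image/sigma_algebra_measurable.
case: n => [|n] in f mf *; first by rewrite big_ord0.
rewrite -bigcup_mkord_ord; apply: bigcup_sub => i Ii A [B mB <-].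
by rewrite /image_set_system/= !setTI; have := mf (inord i) measurableT B mB;
  rewrite setTI.
Qed.

Definition rV_cons n (p : measurableTypeR R * 'rV[R]_n) : 'rV[R]_n.+1 :=
  row_mx (p.1 : R)%:M p.2.

Lemma rV_consE n (p : measurableTypeR R * 'rV[R]_n) (i : 'I_n.+1) :
  rV_cons p 0%R i = if unlift ord0 i is Some j then p.2 0%R j else p.1.
Proof.
rewrite /rV_cons; case: unliftP => [j ->|->].
- have -> : lift ord0 j = rshift 1 j by exact/val_inj.
  exact: (row_mxEr (p.1 : R)%:M p.2 0%R j).
- have -> : ord0 = lshift n (ord0 : 'I_1) by exact/val_inj.
  by rewrite (row_mxEl (p.1 : R)%:M p.2 0%R 0%R) mxE eqxx mulr1n.
Qed.

Lemma measurable_rV_cons n : measurable_fun setT (@rV_cons n).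
Proof.
apply: measurable_rVP => i.
under eq_fun do rewrite rV_consE.
case: (unlift ord0 i) => [j|]; last exact: measurable_fst.
apply: (@measurableT_comp _ _ _ _ _ _ (fun x : 'rV[R]_n => x 0%R j : R)).
  exact: measurable_coord.
exact: measurable_snd.
Qed.

Definition rV_uncons n (x : 'rV[R]_n.+1) : measurableTypeR R * 'rV[R]_n :=
  (x 0%R ord0 : R, \row_j x 0%R (lift ord0 j)).

Lemma measurable_rV_uncons n : measurable_fun setT (@rV_uncons n).
Proof.
apply: measurable_fun_pair; first exact: measurable_coord.
apply: measurable_rVP => i; under eq_fun do rewrite mxE.
exact: measurable_coord.
Qed.

Lemma rV_consK n : cancel (@rV_cons n) (@rV_uncons n).
Proof.
move=> [a y]; rewrite /rV_uncons rV_consE unlift_none /=; congr pair.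
by apply/rowP => j; rewrite mxE rV_consE liftK.
Qed.

Section cons_measure.
Variables (n : nat) (m : {sigma_finite_measure set 'rV[R]_n -> \bar R}).

Let mu := pushforward (lebesgue_measure \x m) (@rV_cons n).

Let mf : measurable_fun setT (@rV_cons n) := @measurable_rV_cons n.

Let mu0 : mu set0 = 0. Proof. exact: measure0. Qed.

Let mu_ge0 A : 0 <= mu A. Proof. exact: measure_ge0. Qed.

Let mu_sigma_additive : semi_sigma_additive mu.
Proof. exact: measure_semi_sigma_additive. Qed.

HB.instance Definition _ := isMeasure.Build _ _ _ mu
  mu0 mu_ge0 mu_sigma_additive.

Let mu_sigma_finite : sigma_finite setT mu.
Proof.
suff [F TF Foo] : sigma_finite setT (lebesgue_measure \x m).
  exists (fun k => @rV_uncons n @^-1` F k).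
    by rewrite -preimage_bigcup -TF preimage_setT.
  move=> k; have [mF Fk] := Foo k; split.
    by rewrite -[X in measurable X]setTI; exact: measurable_rV_uncons.
  rewrite /mu /pushforward -comp_preimage.
  by rewrite (_ : _ \o _ = id) ?preimage_id//; exact/funext/rV_consK.
have /sigma_finiteP[F [TF ndF Foo]] := sigma_finiteT (@lebesgue_measure R).
have /sigma_finiteP[G [TG ndG Goo]] := sigma_finiteT m.
exists (fun k => F k `*` G k).
  rewrite -setXTT TF TG predeqE => -[x y]; split.
    move=> [/= [k _ Fkx] [l _ Gly]]; exists (maxn k l) => //; split.
    - by move: x Fkx; exact/subsetPset/ndF/leq_maxl.
    - by move: y Gly; exact/subsetPset/ndG/leq_maxr.
  by move=> [k _ []/= ? ?]; split; exists k.
move=> k; have [? ?] := Foo k; have [? ?] := Goo k.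
split; first exact: measurableX.
by rewrite product_measure1E// lte_mul_pinfty// ge0_fin_numE.
Qed.

HB.instance Definition _ := Measure_isSigmaFinite.Build _ _ _ mu mu_sigma_finite.

Definition rV_cons_measure : {sigma_finite_measure set 'rV[R]_n.+1 -> \bar R} :=
  mu.

End cons_measure.

Fixpoint lebesgue_rV n : {sigma_finite_measure set 'rV[R]_n -> \bar R} :=
  if n is m.+1 then rV_cons_measure (lebesgue_rV m) else \d_(0%R : 'rV[R]_0).

End lebesgue_rV.

Section euclidean.
Context {R : realType}.
Variable n : nat.
Implicit Types x nu : 'rV[R]_n.

Definition enorm x : R := Num.sqrt (\sum_i x 0 i ^+ 2).

Definition sphere : set 'rV[R]_n := [set nu | enorm nu = 1].

Definition punctured_ball : set 'rV[R]_n := [set x | 0 < enorm x <= 1].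

Definition direction x : 'rV[R]_n := (enorm x)^-1 *: x.

Lemma enormE x : enorm x = (\sum_i x 0 i ^+ 2) `^ 2^-1.
Proof. by rewrite powR12_sqrt// sumr_ge0// => i _; rewrite sqr_ge0. Qed.

Lemma measurable_enorm : measurable_fun setT enorm.
Proof.
rewrite (_ : enorm = fun x => (\sum_i x 0 i ^+ 2) `^ 2^-1); last first.
  exact/funext/enormE.
apply: (measurableT_comp (measurable_powR _)).
apply: measurable_sum => i; apply: measurable_funX; exact: measurable_coord.
Qed.

Lemma measurable_punctured_ball : measurable punctured_ball.
Proof.
rewrite (_ : punctured_ball = enorm @^-1` `]0, 1]).
  by rewrite -[X in measurable X]setTI; exact: measurable_enorm.
by apply/seteqP; split => x /=; rewrite in_itv.
Qed.

Lemma measurable_direction : measurable_fun setT direction.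
Proof.
apply: measurable_rVP => i; under eq_fun do rewrite mxE.
apply: measurable_funM; last exact: measurable_coord.
under eq_fun do rewrite -powR_inv1 ?sqrtr_ge0//.
exact: (measurableT_comp (measurable_powR _) measurable_enorm).
Qed.

(* The normalized round measure as the cone measure: the normalized Lebesgue
   measure of the part of the unit ball lying over a set of directions. *)
Definition sphere_measure (A : set 'rV[R]_n) : \bar R :=
  ((fine (lebesgue_rV n punctured_ball))^-1%:E *
   lebesgue_rV n (punctured_ball `&` direction @^-1` A))%E.

Let mf := measurable_direction.

Let ball_inv_ge0 : 0 <= (fine (lebesgue_rV n punctured_ball))^-1.
Proof. by rewrite invr_ge0 fine_ge0. Qed.

Let cone : set 'rV[R]_n -> \bar R :=
  pushforward (mscale (NngNum ball_inv_ge0)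
    (mrestr (lebesgue_rV n) measurable_punctured_ball)) direction.

Let coneE : cone = sphere_measure.
Proof. by apply/funext => A; rewrite /sphere_measure setIC. Qed.

Let sphere_measure0 : sphere_measure set0 = 0%E.
Proof. by rewrite -coneE; exact: measure0. Qed.

Let sphere_measure_ge0 A : (0 <= sphere_measure A)%E.
Proof. by rewrite -coneE; exact: measure_ge0. Qed.

Let sphere_measure_sigma_additive : semi_sigma_additive sphere_measure.
Proof. by rewrite -coneE; exact: measure_semi_sigma_additive. Qed.

HB.instance Definition _ := isMeasure.Build _ _ _ sphere_measure
  sphere_measure0 sphere_measure_ge0 sphere_measure_sigma_additive.

End euclidean.

Section geometry.
Context {R : realType}.
Variables (n : nat) (Omega : set 'rV[R]_n).
Implicit Types x nu : 'rV[R]_n.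
Local Open Scope ereal_scope.

Definition rho nu x : \bar R :=
  ereal_inf [set `|s|%R%:E | s in [set s : R | ~ Omega (x + s *: nu)%R]].

(* Here [0^-1 = +oo] and [+oo^-1 = 0], so that [d = +oo] when the integral
   vanishes. *)
Definition mean_distance2 x : \bar R :=
  (sqrte (n%:R%:E *
     \int[@sphere_measure R n]_(nu in @sphere R n) (rho nu x ^+ 2)^-1))^-1.

Definition quasi_inradius : \bar R :=
  (Num.sqrt n%:R)%:E * ereal_sup [set mean_distance2 x | x in Omega].

(* For a unit vector [nu], [s |-> x + s *: nu] is an isometry onto the line, so
   that components and their lengths are computed in the parameter [s]; the
   length of an interval is its Lebesgue measure.  Adjoining 0 makes the
   supremum of an empty family of lengths equal to 0. *)
Definition max_chord nu x : \bar R :=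
  let S := [set s : R | Omega (x + s *: nu)%R] in
  ereal_sup (0 |` [set lebesgue_measure (connected_component S s) | s in S]).

(* The rows of [hyperplane_frame nu] are an orthonormal basis of the orthogonal
   complement of the unit vector [nu], which is thereby identified with R^(n-1)
   together with its Lebesgue measure.  The Lebesgue measure being rotation
   invariant, the choice of the basis is irrelevant. *)
Definition hyperplane_frame nu : 'M[R]_(n.-1, n) :=
  xget 0%R [set B : 'M[R]_(n.-1, n) | (B *m B^T = 1%:M /\ B *m nu^T = 0)%R].

(* [sphere_measure] is concentrated on the unit sphere, whence an essential
   supremum over unit vectors only. *)
Definition essential_diameter : \bar R :=
  ess_sup (@sphere_measure R n) (fun nu =>
    ess_sup (@lebesgue_rV R n.-1) (fun y =>
      max_chord nu (y *m hyperplane_frame nu)%R)).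

End geometry.

Section lamb.
Context {R : realType}.

Definition bessel_J0 (r : R) : R :=
  limn (series (fun k => (-1) ^+ k / (k`!%:R ^+ 2) * (r / 2) ^+ (2 * k))).

Definition lamb_constant : R :=
  inf [set r : R | 0 < r /\ bessel_J0 r + 2 * r * derive1 bessel_J0 r = 0].

End lamb.

Section sobolev.
Context {R : realType}.
Variables (n : nat) (Omega : set 'rV[R]_n).
Implicit Types (u phi : 'rV[R]_n -> R) (Du : 'rV[R]_n -> 'rV[R]_n).

Definition partial (i : 'I_n) phi : 'rV[R]_n -> R :=
  fun x => 'D_(delta_mx 0 i) phi x.

Definition smooth phi := forall s : seq 'I_n,
  let f := foldr partial phi s in
  continuous f /\ forall x i, derivable f x (delta_mx 0 i).

Definition test_function phi :=
  let K := closure [set x | phi x != 0] in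
  [/\ smooth phi, compact K & K `<=` Omega].

Definition weak_gradient u Du := forall phi i, test_function phi ->
  \int[lebesgue_rV n]_(x in Omega) (u x * partial i phi x) =
  - \int[lebesgue_rV n]_(x in Omega) (Du x 0 i * phi x).

Definition square_integrable u := measurable_fun Omega u /\
  (\int[lebesgue_rV n]_(x in Omega) (u x ^+ 2)%:E < +oo)%E.

Definition in_H1 u Du := [/\ square_integrable u,
  forall i, square_integrable (fun x => Du x 0 i) & weak_gradient u Du].

Definition H1_dist2 u Du phi : \bar R :=
  (\int[lebesgue_rV n]_(x in Omega) ((u x - phi x) ^+ 2)%:E +
   \int[lebesgue_rV n]_(x in Omega)
     (enorm (Du x - \row_i partial i phi x) ^+ 2)%:E)%E.

(* [u] lies in the closure of the test functions in the H^1 norm; [Du] is its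
   weak gradient. *)
Definition in_H1_0 u Du := in_H1 u Du /\
  forall eps : R, 0 < eps ->
    exists2 phi, test_function phi & (H1_dist2 u Du phi < eps%:E)%E.

End sobolev.

Definition domain {R : realType} n (Omega : set 'rV[R]_n) :=
  [/\ open Omega, connected Omega & Omega !=set0].

(* Main.v *)
Require Import Defs.
From HB Require Import structures.
From mathcomp Require Import all_boot all_order all_algebra.
From mathcomp Require Import all_classical all_reals all_analysis.
From mathcomp Require Import measurable_realfun ess_sup_inf ring lra.

(** Fix a direction nu. On a chord of Omega parallel to nu, of length at most D,
    a test function v satisfies the one-dimensional Hardy inequality
      int v'^2 >= int (1 / (4 rho^2) + q^2) v^2,
    where rho is the distance to the nearer end of the chord and
    q D / 2 < lambda_0. The reason is that phi(r) = sqrt r J_0(q r) solves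
    phi'' + (1 / (4 r^2) + q^2) phi = 0 and, while q r < lambda_0, is positive
    and increasing: phi'(r) = (J_0(q r) + 2 q r J_0'(q r)) / (2 sqrt r), whose
    first zero is what Lamb's constant names. Hence W = phi' / phi is a
    nonnegative solution of the Riccati equation
    W' + W^2 + 1 / (4 r^2) + q^2 = 0 ([lamb_weight]), and integrating
    (v' - W v)^2 >= 0 over either half of the chord leaves only a boundary term
    at the midpoint, of the good sign ([riccati_inequality], [hardy_interval]).
    An open subset of the line is treated component by component
    ([hardy_line]).

    Integrating over the lines of direction nu ([hardy_in_direction]) and then
    averaging over the sphere gives the inequality for test functions
    ([hardy_test]): the mean of (nu . grad phi)^2 is |grad phi|^2 / N
    ([integral_sphere_dot]), and N times the mean of rho_nu(x)^-2 is
    d_{Omega,M,2}(x)^-2, hence at least N / mu^2 ([inve_quasi_inradius_le]).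
    So the constant is N / (4 mu^2) + N q^2 for each q < 2 lambda_0 / D, where D
    is the essential diameter, and letting q increase to 2 lambda_0 / D yields
    the second term ([admissible_frequency], [mule_le_of_lt]). Slicing and
    averaging both need Lebesgue measure to be invariant under orthogonal maps;
    this is derived from translation invariance and Tonelli's theorem
    ([integral_rV_orthogonal]).

    Passing to H^1_0 is a density argument ([in_H1_0_extend]). The constant may
    be infinite (for instance when D = 0, or a priori when mu = 0), so the
    density argument is applied to the real numbers below it. *)

Import Order.TTheory GRing.Theory Num.Theory.
Import numFieldNormedType.Exports.
Local Open Scope classical_set_scope.
Local Open Scope ring_scope.

Set Implicit Arguments.
Unset Strict Implicit.
Unset Printing Implicit Defensive.

(** * Bessel's equation and the Lamb weight *)

Section lamb_weight.
Context {R : realType}.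
Implicit Types (c : R^nat) (x q h r s : R).

(** This growth condition is inherited by the coefficients of the derivative and
    makes the series converge everywhere, so that termwise differentiation can
    be iterated freely. *)
Definition factorial2_bounded c := forall k, `|c k| <= (k`!%:R ^+ 2)^-1.

Lemma factorial2_bounded_diffs c :
  factorial2_bounded c -> factorial2_bounded (pseries_diffs c).
Proof.
move=> cb k; rewrite /pseries_diffs normrM normr_nat.
apply: (le_trans (ler_wpM2l _ (cb k.+1))); first by rewrite ler0n.
rewrite factS natrM exprMn invfM mulrA ler_piMl ?invr_ge0 ?exprn_ge0//.
by rewrite expr2 invfM mulrA divff ?pnatr_eq0// mul1r invf_le1 ?ltr0n// ler1n.
Qed.

Lemma is_cvg_factorial2_bounded c x :
  factorial2_bounded c -> cvgn (pseries c x).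
Proof.
move=> cb; apply: normed_cvg.
apply: (series_le_cvg _ _ _ (is_cvg_series_exp_coeff `|x|)) => k /=.
- exact: normr_ge0.
- by rewrite /exp_coeff/= divr_ge0 ?exprn_ge0.
- rewrite normrM normrX /exp_coeff/= mulrC ler_wpM2l ?exprn_ge0//.
  apply: (le_trans (cb k)).
  rewrite lef_pV2 ?posrE ?exprn_gt0 ?ltr0n ?fact_gt0// expr2 ler_peMl//.
  by rewrite ler1n fact_gt0.
Qed.

Lemma is_derive_factorial2_bounded c x : factorial2_bounded c ->
  is_derive x 1 (fun y => limn (pseries c y)) (limn (pseries (pseries_diffs c) x)).
Proof.
move=> cb; apply: (@pseries_snd_diffs _ _ (`|x| + 1)).
- exact: is_cvg_factorial2_bounded.
- exact/is_cvg_factorial2_bounded/factorial2_bounded_diffs.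
- exact/is_cvg_factorial2_bounded/factorial2_bounded_diffs/factorial2_bounded_diffs.
- by rewrite (ger0_norm (addr_ge0 _ _))// ltrDl.
Qed.

Definition bessel_coeff k : R := (-1) ^+ k / k`!%:R ^+ 2.

Lemma bessel_coeff_bounded : factorial2_bounded bessel_coeff.
Proof.
move=> k; rewrite /bessel_coeff normrM normrX normrN1 expr1n mul1r.
by rewrite ger0_norm// invr_ge0 exprn_ge0.
Qed.

(** The n-th derivative of B(s) = sum_k (-s)^k / (k!)^2. Since J_0(r) = B(r^2/4),
    working with B makes every Bessel identity a polynomial one. *)
Definition bessel_series (n : nat) x : R :=
  limn (pseries (iter n (@pseries_diffs R) bessel_coeff) x).

Lemma is_derive_bessel_series n x :
  is_derive x 1 (bessel_series n) (bessel_series n.+1 x).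
Proof.
apply: is_derive_factorial2_bounded.
by elim: n => [|n]; [exact: bessel_coeff_bounded|exact: factorial2_bounded_diffs].
Qed.

Lemma cvg_bessel_series n x :
  pseries (iter n (@pseries_diffs R) bessel_coeff) x @ \oo --> bessel_series n x.
Proof.
apply: is_cvg_factorial2_bounded.
by elim: n => [|n]; [exact: bessel_coeff_bounded|exact: factorial2_bounded_diffs].
Qed.

(** Bessel's equation of order 0 in the variable s; it holds term by term, because
    the coefficients satisfy b_k = - (k + 1)^2 b_(k+1). *)
Lemma bessel_ode x :
  x * bessel_series 2 x + bessel_series 1 x + bessel_series 0 x = 0.
Proof.
have h2 := @pseries_diffs_equiv _ (pseries_diffs bessel_coeff) x
  (@cvg_bessel_series 2 x).
have h := cvgD (cvgD (cvgM (cvg_cst x) h2) (@cvg_bessel_series 1 x))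
  (@cvg_bessel_series 0 x).
rewrite -(cvg_lim (@Rhausdorff R) (h _ _ _ _)).
apply: cvg_lim => //; apply: cvg_near_cst; apply: nearW => n /=.
transitivity (\sum_(0 <= i < n) (x * (i%:R * pseries_diffs bessel_coeff i *
    x ^+ i.-1) + pseries_diffs bessel_coeff i * x ^+ i + bessel_coeff i * x ^+ i)).
  by rewrite !big_split/= -mulr_sumr.
apply: big1 => i _.
suff -> : bessel_coeff i = - (i.+1%:R * pseries_diffs bessel_coeff i).
  by case: i => [|i]/=; rewrite ?exprS; ring.
rewrite /pseries_diffs /bessel_coeff [(-1) ^+ i.+1]exprS factS natrM.
have : i`!%:R != 0 :> R by rewrite pnatr_eq0 -lt0n fact_gt0.
have : i.+1%:R != 0 :> R by rewrite pnatr_eq0.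
by move: (i.+1%:R) (i`!%:R) => a f a0 f0; field; rewrite a0 f0.
Qed.

Let B n s := bessel_series n s.

Lemma bessel_J0E r : bessel_J0 r = B 0 (r ^+ 2 / 4).
Proof.
rewrite /bessel_J0 /B /bessel_series/= /pseries; congr (limn (series _)).
by apply/funext => k; rewrite exprM expr_div_n [2 ^+ 2](_ : _ = 4)//; ring.
Qed.

Lemma is_derive_bessel_J0 r :
  is_derive r 1 (@bessel_J0 R) (r / 2 * B 1 (r ^+ 2 / 4)).
Proof.
have -> : @bessel_J0 R = B 0 \o (fun r => r ^+ 2 / 4).
  by apply/funext => y; rewrite bessel_J0E.
have d : is_derive r 1 (fun r : R => r ^+ 2 / 4) (r / 2).
  by apply: is_derive_eq; rewrite /GRing.scale/=; field.
have := @is_derive1_comp _ _ (fun r => r ^+ 2 / 4) _ _ _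
    (is_derive_bessel_series 0 (r ^+ 2 / 4)) d.
by rewrite mulrC.
Qed.

(** With r = 2 sqrt s, the function defining Lamb's constant is
    J_0(r) + 2 r J_0'(r) = B(s) + 4 s B'(s). *)
Definition lamb_function s : R := B 0 s + 4 * s * B 1 s.

Lemma lamb_functionE r :
  bessel_J0 r + 2 * r * derive1 bessel_J0 r = lamb_function (r ^+ 2 / 4).
Proof.
rewrite derive1E (@derive_val _ _ _ _ _ _ _ (is_derive_bessel_J0 r)).
by rewrite bessel_J0E /lamb_function; field.
Qed.

Lemma continuous_bessel_series n : continuous (bessel_series n).
Proof.
move=> s; apply/differentiable_continuous/derivable1_diffP.
by case: (is_derive_bessel_series n s).
Qed.

Lemma continuous_lamb_function : continuous lamb_function.
Proof.
move=> s; apply: cvgD; first exact: continuous_bessel_series.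
by apply: cvgM; [apply: cvgM; [exact: cvg_cst|exact: cvg_id]|
  exact: continuous_bessel_series].
Qed.

Lemma bessel_series0 : B 0 0 = 1.
Proof.
apply: cvg_lim => //; apply: cvg_near_cst; near=> n.
have n0 : (0 < n)%N by near: n; exists 1%N.
rewrite /= /pseries seriesEnat/= -(prednK n0) big_nat_recl//= big1.
  by rewrite /bessel_coeff fact0 expr1n divr1 expr0 mulr1 addr0.
by move=> i _; rewrite expr0n mulr0.
Unshelve. all: by end_near. Qed.

(** The function equals 1 at 0, so a nonpositive value would produce, by the
    intermediate value theorem, a positive zero below their infimum. *)
Lemma lamb_function_gt0 r : 0 <= r < lamb_constant ->
  0 < lamb_function (r ^+ 2 / 4).
Proof.
move=> /andP[r0 rl]; rewrite ltNge; apply/negP => fr0.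
have l1 : lamb_function 0 = 1.
  by rewrite /lamb_function mulr0 mul0r addr0 bessel_series0.
pose f (x : R) := lamb_function (x ^+ 2 / 4).
have cf : continuous f.
  move=> x; apply: (@continuous_comp _ _ _ (fun x : R => x ^+ 2 / 4) lamb_function).
    by apply: cvgM; [exact: exprn_continuous|exact: cvg_cst].
  exact: continuous_lamb_function.
have f0 : f 0 = 1 by rewrite /f expr0n mul0r.
have [||z] := @IVT R f 0 r 0 r0.
- exact: continuous_subspaceT.
- rewrite f0; apply/andP; split.
    by rewrite ge_min /f fr0 orbT.
  by rewrite le_max ler01.
rewrite in_itv/= => /andP[z0 zr] fz.
have {}z0 : 0 < z.
  by rewrite lt_neqAle z0 andbT; apply/eqP => zE; move: fz; rewrite -zE f0 => /eqP;
    rewrite oner_eq0.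
suff : lamb_constant <= z by rewrite leNgt (le_lt_trans zr rl).
apply: ge_inf; first by exists 0 => y [/ltW].
by split => //; rewrite lamb_functionE.
Qed.

(** If Lamb's function is positive up to r, then sqrt x J_0(x) increases from 0
    there, whence J_0(r) > 0. The substitution of x^2 for x removes the
    singularity of the square root at 0. *)
Lemma bessel_gt0 r : 0 <= r < lamb_constant -> 0 < B 0 (r ^+ 2 / 4).
Proof.
(* the derivative of x |-> x B(x^4/4) is the Lamb function at x^4/4 *)
move=> /andP[r0 rl]; move: r0; rewrite le_eqVlt => /predU1P[<-|r0].
  by rewrite expr0n mul0r bessel_series0.
pose psi (x : R) := x * B 0 (x ^+ 4 / 4).
have dpsi (x : R) : is_derive x 1 psi (lamb_function (x ^+ 4 / 4)).
  have d : is_derive x 1 (fun r : R => r ^+ 4 / 4) (x ^+ 3).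
    by apply: is_derive_eq; rewrite /GRing.scale/=; field.
  have dB := @is_derive1_comp _ _ (fun x => x ^+ 4 / 4) _ _ _
    (is_derive_bessel_series 0 (x ^+ 4 / 4)) d.
  apply: (is_derive_eq (is_deriveM (is_derive_id x 1) dB)).
  by rewrite /lamb_function /B /GRing.scale/=; field.
have x0 : 0 < Num.sqrt r by rewrite sqrtr_gt0.
have cpsi : {within `[0, Num.sqrt r], continuous psi}.
  apply: continuous_subspaceT => x; apply/differentiable_continuous.
  by apply/derivable1_diffP; case: (dpsi x).
have [z /[!in_itv]/= /andP[z0 zr]] := MVT x0 (fun x _ => dpsi x) cpsi.
rewrite subr0 {2}/psi mul0r subr0 => psiE.
have : 0 < psi (Num.sqrt r).
  rewrite psiE mulr_gt0// -[4%N]/(2 * 2)%N exprM lamb_function_gt0// sqr_ge0/=.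
  by rewrite (lt_trans _ rl)// -[ltRHS](sqr_sqrtr (ltW r0)) ltrXn2r// ltW.
by rewrite /psi pmulr_rgt0// -[4%N]/(2 * 2)%N exprM sqr_sqrtr// ltW.
Qed.

(** The weight is the logarithmic derivative of sqrt r J_0(q r), that is
    1 / (2 r) + q J_0'(q r) / J_0(q r); for q = 0 only the first term remains. Its
    value at h has the sign of Lamb's function at q h. *)
Lemma lamb_weight q h : 0 <= q -> 0 < h -> q = 0 \/ q * h < lamb_constant ->
  exists w : R -> R,
    (forall r, 0 < r <= h ->
      is_derive r 1 w (- (w r ^+ 2 + (q ^+ 2 + (4 * r ^+ 2)^-1)))) /\ 0 <= w h.
Proof.
move=> q0 h0 [->|qh].
  exists (fun r => (2 * r)^-1); split; last by rewrite invr_ge0 mulr_ge0// ltW.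
  move=> r /andP[r0 _]; have r2 : 2 * r != 0 by rewrite mulf_neq0// gt_eqF.
  have dr : is_derive r 1 (fun r : R => 2 * r) 2.
    by apply: is_derive_eq; rewrite /GRing.scale/=; ring.
  apply: (is_derive_eq (is_deriveV r2 dr)); rewrite /GRing.scale/=.
  by field; rewrite gt_eqF.
pose s (r : R) := (q * r) ^+ 2 / 4.
exists (fun r => (2 * r)^-1 + q ^+ 2 * r / 2 * (B 1 (s r) / B 0 (s r))).
split=> [r /andP[r0 rh]|].
  have B0 : B 0 (s r) != 0.
    rewrite gt_eqF// /s bessel_gt0// mulr_ge0//=; last exact: ltW.
    by rewrite (le_lt_trans _ qh)// ler_wpM2l.
  have r2 : 2 * r != 0 by rewrite mulf_neq0// gt_eqF.
  have dr : is_derive r 1 (fun r : R => 2 * r) 2.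
    by apply: is_derive_eq; rewrite /GRing.scale/=; ring.
  have ds : is_derive r 1 s (q ^+ 2 * r / 2).
    by apply: is_derive_eq; rewrite /GRing.scale/=; field.
  have dB n : is_derive r 1 (B n \o s) (B n.+1 (s r) * (q ^+ 2 * r / 2)).
    exact: is_derive1_comp (is_derive_bessel_series n (s r)) ds.
  have dV := @is_deriveV _ (B 0 \o s) r _ 1 B0 (dB 0).
  have dq : is_derive r 1 (fun r : R => q ^+ 2 * r / 2) (q ^+ 2 / 2).
    by apply: is_derive_eq; rewrite /GRing.scale/=; field.
  apply: (is_derive_eq
    (is_deriveD (is_deriveV r2 dr) (is_deriveM dq (is_deriveM (dB 1%N) dV)))).
  have : s r * B 2 (s r) + B 1 (s r) + B 0 (s r) = 0 := bessel_ode (s r).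
  move=> ode; apply/eqP; rewrite -subr_eq0; apply/eqP.
  (* the defect in the Riccati equation is q^2 / B(s) times Bessel's equation *)
  rewrite -[RHS](mulr0 (q ^+ 2 / B 0 (s r))) -ode /GRing.scale/=.
  rewrite -[(_ * _ : R -> R) r]/(B 1 (s r) / B 0 (s r)).
  rewrite -[B 0.+1]/(B 1) -[B 1.+1]/(B 2).
  move: (B 0 (s r)) (B 1 (s r)) (B 2 (s r)) B0 => b0 b1 b2 b0N0.
  by rewrite /s; field; rewrite b0N0 gt_eqF.
have hB : 0 < B 0 (s h) by rewrite bessel_gt0// mulr_ge0//= ltW.
have : 0 <= lamb_function (s h).
  by rewrite ltW// lamb_function_gt0// mulr_ge0//= ltW.
rewrite /lamb_function => fh.
have -> : (2 * h)^-1 + q ^+ 2 * h / 2 * (B 1 (s h) / B 0 (s h)) =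
   (B 0 (s h) + 4 * s h * B 1 (s h)) / (2 * h * B 0 (s h)).
  by rewrite {4}/s; field; rewrite !gt_eqF.
by rewrite divr_ge0// !mulr_ge0// ltW.
Qed.

End lamb_weight.

(** * The Hardy inequality on the line *)

Section hardy_line.
Context {R : realType}.
Implicit Types (S T K : set R) (v dv w W P : R -> R) (a b q t : R).
Let mu := @lebesgue_measure R.

(** A solution of the Riccati equation certifies the inequality, since
    (v' - W v)^2 = v'^2 - P v^2 - (W v^2)'. *)
Lemma riccati_inequality v dv W P al be : al < be ->
  (forall t, is_derive t 1 v (dv t)) -> continuous dv ->
  (forall t, al <= t <= be -> 0 <= P t /\ {for t, continuous P}) ->
  (forall t, al <= t <= be -> is_derive t 1 W (- (W t ^+ 2 + P t))) ->
  W al * v al ^+ 2 <= W be * v be ^+ 2 ->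
  (\int[mu]_(t in `[al, be]) (v t ^+ 2 * P t)%:E <=
   \int[mu]_(t in `[al, be]) (dv t ^+ 2)%:E)%E.
Proof.
move=> ab vE cdv hP dW bnd.
have cv : continuous v.
  move=> t; apply/differentiable_continuous/derivable1_diffP.
  by case: (vE t).
have cW t : al <= t <= be -> {for t, continuous W}.
  move=> tab; apply/differentiable_continuous/derivable1_diffP.
  by case: (dW t tab).
pose G t := W t * v t ^+ 2.
pose g t : R := - (W t ^+ 2 + P t) * v t ^+ 2 + W t * (v t * dv t *+ 2).
have dG t : al <= t <= be -> is_derive t 1 G (g t).
  move=> tab; have dWt := dW t tab.
  apply: (is_derive_eq (is_deriveM dWt (is_deriveX 2 (vE t)))).
  rewrite /GRing.scale/= -[(v ^+ 2) t]/(v t ^+ 2) expr1 /g; ring.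
have cG t : al <= t <= be -> {for t, continuous G}.
  move=> tab; apply/differentiable_continuous/derivable1_diffP.
  by case: (dG t tab).
have cvX t : {for t, continuous (fun t => v t ^+ 2)}.
  apply: (@continuous_comp _ _ _ v (fun x : R => x ^+ 2)); first exact: cv.
  exact: exprn_continuous.
have cg t : al <= t <= be -> {for t, continuous g}.
  move=> tab; apply: cvgD.
    apply: cvgM; last exact: cvX.
    apply: cvgN; apply: cvgD; last by case: (hP t tab).
    apply: (@continuous_comp _ _ _ W (fun x : R => x ^+ 2)); first exact: cW.
    exact: exprn_continuous.
  apply: cvgM; first exact: cW.
  by apply: cvgMn; apply: cvgM; [exact: cv|exact: cdv].
have cP t : al <= t <= be -> {for t, continuous (fun t => v t ^+ 2 * P t)}.
  by move=> tab; apply: cvgM; [exact: cvX|case: (hP t tab)].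
have cin (f : R -> R) : (forall t, al <= t <= be -> {for t, continuous f}) ->
    {within `[al, be], continuous f}.
  by move=> cf; apply: continuous_in_subspaceT => t /[!inE]/=; rewrite in_itv; exact: cf.
have iin (f : R -> R) : (forall t, al <= t <= be -> {for t, continuous f}) ->
    mu.-integrable `[al, be] (EFin \o f).
  move=> cf; apply: continuous_compact_integrable; first exact: segment_compact.
  exact: cin.
have intg : (\int[mu]_(t in `[al, be]) (g t)%:E = (G be)%:E - (G al)%:E)%E.
  apply: continuous_FTC2 => //; first exact: cin.
    split.
    - move=> t; rewrite in_itv/= => /andP[at_ tb].
      by have := dG t; rewrite !ltW// => /(_ isT) [].
    - by apply: cvg_at_right_filter; apply: cG; rewrite lexx ltW.
    - by apply: cvg_at_left_filter; apply: cG; rewrite lexx ltW.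
  move=> t; rewrite in_itv/= => /andP[at_ tb].
  by rewrite derive1E; have := dG t; rewrite !ltW// => /(_ isT) [].
have bnd' : (0 <= \int[mu]_(t in `[al, be]) (g t)%:E)%E.
  by rewrite intg -EFinB lee_fin subr_ge0.
have cdvX t : al <= t <= be -> {for t, continuous (fun t => dv t ^+ 2)}.
  move=> _; apply: (@continuous_comp _ _ _ dv (fun x : R => x ^+ 2)); first exact: cdv.
  exact: exprn_continuous.
apply: (@le_trans _ _ (\int[mu]_(t in `[al, be]) (v t ^+ 2 * P t + g t)%:E)%E).
  rewrite integralD_EFin//=; [|exact: iin|exact: iin].
  by rewrite leeDl.
apply: le_integral => //=.
- apply: iin => t tab.
  by apply: cvgD; [exact: cP|exact: cg].
- exact: iin.
- move=> t _; rewrite lee_fin -subr_ge0.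
  rewrite (_ : _ - _ = (dv t - W t * v t) ^+ 2) ?sqr_ge0//.
  by rewrite /g; ring.
Qed.

Definition line_dist S t : \bar R :=
  ereal_inf [set `|s|%R%:E | s in [set s | ~ S (t + s)]].

Definition hardy_weight S q t : \bar R :=
  (4^-1%:E * (line_dist S t ^+ 2)^-1 + (q ^+ 2)%:E)%E.

Lemma line_dist_ge0 S t : (0 <= line_dist S t)%E.
Proof. by apply: le_ereal_inf_tmp => _ [s _ <-]; rewrite lee_fin. Qed.

Lemma line_distS S T t : S `<=` T -> (line_dist S t <= line_dist T t)%E.
Proof.
by move=> ST; apply: ereal_inf_le_tmp => _ [s sS <-]; exists s => // /ST.
Qed.

Lemma line_dist_ge S t (d : R) : (forall s, `|s| < d -> S (t + s)) ->
  (d%:E <= line_dist S t)%E.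
Proof.
move=> dS; apply: le_ereal_inf_tmp => _ [s /= nS <-]; rewrite lee_fin leNgt.
by apply/negP => /dS.
Qed.

Lemma hardy_weight_le S q t (d : R) : 0 < d -> (forall s, `|s| < d -> S (t + s)) ->
  (hardy_weight S q t <= (q ^+ 2 + (4 * d ^+ 2)^-1)%:E)%E.
Proof.
move=> d0 dS; rewrite /hardy_weight addeC EFinD leeD2l//.
rewrite invfM EFinM lee_pmul ?lee_fin ?inve_ge0 ?sqre_ge0//.
have -> : ((d ^+ 2)^-1%:E = (d%:E ^+ 2)^-1)%E.
  by rewrite -EFin_expe inver gt_eqF// exprn_gt0.
rewrite lee_pV2 ?inE ?sqre_ge0//.
by rewrite lee_sqr ?line_dist_ge0 ?lee_fin ?(ltW d0)//; exact: line_dist_ge.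
Qed.

Lemma hardy_weight_ge0 S q t : (0 <= hardy_weight S q t)%E.
Proof.
by rewrite adde_ge0 ?lee_fin ?sqr_ge0// mule_ge0// inve_ge0 sqre_ge0.
Qed.

Lemma hardy_weightS S T q t : S `<=` T -> (hardy_weight T q t <= hardy_weight S q t)%E.
Proof.
move=> ST; rewrite /hardy_weight leeD2r// lee_wpmul2l ?lee_fin//.
by rewrite lee_pV2 ?inE ?sqre_ge0// lee_sqr ?line_dist_ge0// line_distS.
Qed.

(** The sublevel sets are unions of balls centred outside S, hence open. *)
Lemma measurable_line_dist S : measurable_fun setT (line_dist S).
Proof.
apply: (measurability _ (ErealGenInftyO.measurableE R)) => _ [_ [c ->] <-].
rewrite setTI; apply: open_measurable.
rewrite (_ : _ @^-1` _ = \bigcup_(z in ~` S) ball z c).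
  by apply: bigcup_open => z _; exact: ball_open.
apply/seteqP; split => t /=.
  rewrite in_itv/= => /ereal_inf_lt[_ [s /= nS <-]]; rewrite lte_fin => sc.
  exists (t + s) => //; rewrite /ball/= addrAC subrr add0r//.
move=> [z nS]; rewrite /ball/= in_itv/= => zc; apply/ereal_inf_ltP.
by exists `|z - t|%:E; [exists (z - t) => //=; rewrite addrCA subrr addr0|].
Qed.
End hardy_line.

Lemma measurable_inve_sqr d (T : measurableType d) (R : realType) (D : set T)
    (f : T -> \bar R) : measurable D -> (forall x, D x -> (0 <= f x)%E) ->
  measurable_fun D f -> measurable_fun D (fun x => (f x ^+ 2)^-1%E).
Proof.
move=> mD f0 mf; apply: (measurability _ (ErealGenOInfty.measurableE R)).
move=> _ [_ [c ->] <-].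
have [c0|c0] := ltP c 0.
  rewrite (_ : _ `&` _ = D)//; apply/seteqP; split => [x []//|x Dx]; split => //=.
  by rewrite in_itv/= andbT (@lt_le_trans _ _ 0%E) ?lte_fin// inve_ge0 sqre_ge0.
rewrite (_ : _ `&` _ = D `&` [set x | (f x < sqrte (c%:E^-1))%E]).
  exact: emeasurable_fun_infty_o.
have c0' : (0 <= c%:E^-1)%E by rewrite inve_ge0.
apply/seteqP; split => x [Dx] /=; rewrite in_itv/= andbT; split => //.
  move: b; rewrite inve_pgt ?inE ?lee_fin ?sqre_ge0// => h.
  by rewrite -lte_sqr ?f0 ?sqrte_ge0// sqr_sqrte.
rewrite inve_pgt ?inE ?lee_fin ?sqre_ge0//.
by move: b; rewrite -lte_sqr ?f0 ?sqrte_ge0// sqr_sqrte.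
Qed.

Lemma integral_subset_zero d (T : measurableType d) (R : realType)
    (mu : {measure set T -> \bar R}) (A B : set T) (f : T -> \bar R) :
  B `<=` A -> (forall x, A x -> ~ B x -> f x = 0%E) ->
  (\int[mu]_(x in A) f x = \int[mu]_(x in B) f x)%E.
Proof.
move=> BA f0; rewrite integral_mkcond [RHS]integral_mkcond.
apply: eq_integral => x _; rewrite /patch.
case: ifPn => xA; case: ifPn => xB //.
  by rewrite f0//; [exact: set_mem|move=> /mem_set; rewrite (negbTE xB)].
by move: xA; rewrite mem_set//; exact/BA/set_mem.
Qed.

Lemma measurable_sqr_continuous {R : realType} (f : R -> R) : continuous f ->
  measurable_fun setT (fun t : measurableTypeR R => (f t ^+ 2)%:E).
Proof.
move=> cf.
apply/measurable_EFinP.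
apply: measurable_funX.
exact: continuous_measurable_fun.
Qed.

Lemma closure_itvoo {R : realType} (x y t : R) : x < y -> x <= t <= y ->
  closure `]x, y[%classic t.
Proof.
move=> xy /andP[xt ty] B /nbhs_ballP[e /= e0 eB].
pose m := (x + y) / 2.
pose d := Num.min 1 (e / (y - x)) / 2.
have yx : 0 < y - x by rewrite subr_gt0.
have d0 : 0 < d by rewrite divr_gt0// lt_min ltr01 divr_gt0.
have d1 : d < 1.
  by rewrite ltr_pdivrMr// mul1r gt_min ltr1n.
have de : d * (y - x) < e.
  by rewrite -ltr_pdivlMr// ltr_pdivrMr// gt_min ltr_pMr ?divr_gt0// ltr1n orbT.
(* moving from t a little towards the midpoint enters the open interval *)
exists (t + d * (m - t)); split.
  by rewrite /= in_itv/= /m; apply/andP; split; nra.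
apply: eB; rewrite /ball/= opprD addrA subrr sub0r normrN normrM gtr0_norm//.
apply: le_lt_trans de; rewrite ler_pM2l// ler_norml /m; apply/andP; split; lra.
Qed.

Section hardy_interval.
Context {R : realType}.
Implicit Types (S T K : set R) (v dv : R -> R) (a b q t : R).
Let mu := @lebesgue_measure R.

Lemma measurable_hardy_integrand S v q : continuous v ->
  measurable_fun setT (fun t => ((v t ^+ 2)%:E * hardy_weight S q t)%E).
Proof.
move=> cv; apply: emeasurable_funM.
  exact: measurable_sqr_continuous.
apply: emeasurable_funD => //; apply: emeasurable_funM => //.
apply: measurable_inve_sqr => //; first by move=> *; exact: line_dist_ge0.
exact: measurable_line_dist.
Qed.

(** [riccati_inequality] with the weight replaced by a smaller one. On half an
    interval the distance to the complement of S is at least the distance to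
    the endpoint of that half, and the latter is smooth. *)
Lemma hardy_piece S v dv q (W P : R -> R) al be : al < be ->
  (forall t, is_derive t 1 v (dv t)) -> continuous dv ->
  (forall t, al <= t <= be -> 0 <= P t /\ {for t, continuous P}) ->
  (forall t, al <= t <= be -> is_derive t 1 W (- (W t ^+ 2 + P t))) ->
  W al * v al ^+ 2 <= W be * v be ^+ 2 ->
  (forall t, al <= t <= be -> (hardy_weight S q t <= (P t)%:E)%E) ->
  (\int[mu]_(t in `[al, be]) ((v t ^+ 2)%:E * hardy_weight S q t) <=
   \int[mu]_(t in `[al, be]) (dv t ^+ 2)%:E)%E.
Proof.
move=> ab vE cdv hP dW bnd wP.
have cv : continuous v.
  by move=> t; apply/differentiable_continuous/derivable1_diffP; case: (vE t).
apply: le_trans (riccati_inequality ab vE cdv hP dW bnd).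
apply: ge0_le_integral => //.
- by move=> t _; rewrite mule_ge0 ?hardy_weight_ge0// lee_fin sqr_ge0.
- by apply: measurable_funTS; exact: measurable_hardy_integrand.
- apply/measurable_EFinP; apply: subspace_continuous_measurable_fun => //.
  apply: continuous_in_subspaceT => t /[!inE]/=; rewrite in_itv/= => /hP[_ cP].
  apply: cvgM => //.
  apply: (@continuous_comp _ _ _ v (fun x : R => x ^+ 2)); first exact: cv.
  exact: exprn_continuous.
- move=> t /=; rewrite in_itv/= => /wP wt.
  by rewrite (EFinM (v t ^+ 2)); apply: lee_pmul; rewrite ?lee_fin ?sqr_ge0 ?hardy_weight_ge0.
Qed.

(** Each half of the interval carries the weight of its own endpoint; the two
    boundary terms at the midpoint have the right sign because the Lamb weight
    is nonnegative there. *)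
Lemma hardy_interval S v dv a b q : a < b -> `]a, b[ `<=` S ->
  (forall t, is_derive t 1 v (dv t)) -> continuous dv ->
  (exists2 e, 0 < e & forall t, a < t < b -> t <= a + e \/ b - e <= t -> v t = 0) ->
  0 <= q -> q = 0 \/ q * ((b - a) / 2) < lamb_constant ->
  (\int[mu]_(t in `]a, b[) ((v t ^+ 2)%:E * hardy_weight S q t) <=
   \int[mu]_(t in `]a, b[) (dv t ^+ 2)%:E)%E.
Proof.
move=> ab abS vE cdv [e e0 ve] q0 ql.
have cv : continuous v.
  by move=> t; apply/differentiable_continuous/derivable1_diffP; case: (vE t).
set f := fun t => (_ * _)%E.
have mf : measurable_fun setT f by exact: measurable_hardy_integrand.
have f0 t : (0 <= f t)%E by rewrite mule_ge0 ?hardy_weight_ge0// lee_fin sqr_ge0.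
have mdv : measurable_fun setT (fun t => (dv t ^+ 2)%:E).
  exact: measurable_sqr_continuous.
have dv0 t : (0 <= (dv t ^+ 2)%:E)%E by rewrite lee_fin sqr_ge0.
pose h := (b - a) / 2; pose m := a + h.
have mE : m = a + h by [].
have h0 : 0 < h by rewrite divr_gt0// subr_gt0.
have bh : b = m + h by rewrite /m /h; field.
(* w is singular at the endpoints; v vanishes within d of them, so the
   integrals may start at distance d *)
pose d := Num.min e (h / 2).
have d0 : 0 < d by rewrite lt_min e0 divr_gt0.
have de : d <= e by rewrite ge_min lexx.
have dh : d <= h / 2 by rewrite ge_min lexx orbT.
have [w [dw wh]] := lamb_weight q0 h0 ql.
have cP (c t : R) (g : R -> R) : g t = c -> c != 0 -> {for t, continuous g} ->
    {for t, continuous (fun t => q ^+ 2 + (4 * g t ^+ 2)^-1)}.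
  move=> gt c0 cg; apply: cvgD; first exact: cvg_cst.
  apply: cvgV; first by rewrite gt mulf_neq0// expf_neq0.
  apply: cvgM; first exact: cvg_cst.
  by apply: (@continuous_comp _ _ _ g (fun x : R => x ^+ 2)) => //; exact: exprn_continuous.
have left : (\int[mu]_(t in `[(a + d)%R, m]) f t <=
    \int[mu]_(t in `[(a + d)%R, m]) (dv t ^+ 2)%:E)%E.
  apply: (@hardy_piece S v dv q (fun t => w (t - a))
    (fun t => q ^+ 2 + (4 * (t - a) ^+ 2)^-1)) => //.
  - by lra.
  - move=> t /andP[t1 t2]; have ta : 0 < t - a by lra.
    split; first by rewrite addr_ge0 ?sqr_ge0// invr_ge0 mulr_ge0// sqr_ge0.
    apply: (cP (t - a)) => //; first by rewrite gt_eqF.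
    by apply: cvgB; [exact: cvg_id|exact: cvg_cst].
  - move=> t /andP[t1 t2]; have ta : 0 < t - a <= h by lra.
    have dta : is_derive t 1 (fun t : R => t - a) 1.
      by apply: is_derive_eq; rewrite subr0.
    have := @is_derive1_comp _ w (fun t => t - a) _ _ _ (dw _ ta) dta.
    by rewrite mulr1.
  - rewrite (ve (a + d)) ?expr0n ?mulr0 /=.
    + by rewrite {1}/m addrAC subrr add0r mulr_ge0 ?sqr_ge0.
    + by apply/andP; split; lra.
    + by left; lra.
  - move=> t /andP[t1 t2]; apply: hardy_weight_le; first lra.
    move=> s st; apply: abS; rewrite /= in_itv/=.
    by move: st; rewrite ltr_norml; lra.
have right : (\int[mu]_(t in `[m, (b - d)%R]) f t <=
    \int[mu]_(t in `[m, (b - d)%R]) (dv t ^+ 2)%:E)%E.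
  apply: (@hardy_piece S v dv q (fun t => - w (b - t))
    (fun t => q ^+ 2 + (4 * (b - t) ^+ 2)^-1)) => //.
  - by lra.
  - move=> t /andP[t1 t2]; have ta : 0 < b - t by lra.
    split; first by rewrite addr_ge0 ?sqr_ge0// invr_ge0 mulr_ge0// sqr_ge0.
    apply: (cP (b - t)) => //; first by rewrite gt_eqF.
    by apply: cvgB; [exact: cvg_cst|exact: cvg_id].
  - move=> t /andP[t1 t2]; have ta : 0 < b - t <= h by lra.
    have dta : is_derive t 1 (fun t : R => b - t) (-1).
      apply: (is_derive_eq (is_deriveB (is_derive_cst b t 1) (is_derive_id t 1))).
      by rewrite sub0r.
    have := is_deriveN (@is_derive1_comp _ w (fun t => b - t) _ _ _ (dw _ ta) dta).
    by rewrite mulrN1 opprK sqrrN.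
  - rewrite (ve (b - d)) ?expr0n ?mulr0 /=.
    + by rewrite {1}bh addrAC subrr add0r mulNr oppr_le0 mulr_ge0 ?sqr_ge0.
    + by apply/andP; split; lra.
    + by right; lra.
  - move=> t /andP[t1 t2]; apply: hardy_weight_le; first lra.
    move=> s st; apply: abS; rewrite /= in_itv/=.
    by move: st; rewrite ltr_norml; lra.
have abE : `]a, b[%classic = `]a, m] `|` `]m, b[.
  by rewrite -itv_bndbnd_setU// bnd_simp; lra.
have disj : [disjoint `]a, m]%classic & `]m, b[%classic].
  rewrite disj_set2E; apply/eqP; rewrite -subset0 => t /= [].
  by rewrite !in_itv/=; lra.
have S1 : `[a + d, m] `<=` `]a, m] by move=> t /=; rewrite !in_itv/=; lra.
have S2 : `]m, b - d] `<=` `]m, b[ by move=> t /=; rewrite !in_itv/=; lra.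
have E1 : (\int[mu]_(t in `]a, m]) f t = \int[mu]_(t in `[(a + d)%R, m]) f t)%E.
  apply: integral_subset_zero => // t; rewrite /= !in_itv/= => tI tJ.
  by rewrite /f ve ?expr0n ?mul0e//; [lra|left; move: tJ => /negP; lra].
have E2 : (\int[mu]_(t in `]m, b[) f t = \int[mu]_(t in `[m, (b - d)%R]) f t)%E.
  rewrite -integral_itv_obnd_cbnd; last exact: measurable_funTS.
  apply: integral_subset_zero => // t; rewrite /= !in_itv/= => tI tJ.
  by rewrite /f ve ?expr0n ?mul0e//; [lra|right; move: tJ => /negP; lra].
have split g : measurable_fun setT g -> (forall t, 0 <= g t)%E ->
    (\int[mu]_(t in `]a, b[) g t =
     \int[mu]_(t in `]a, m]) g t + \int[mu]_(t in `]m, b[) g t)%E.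
  move=> mg g0; rewrite abE ge0_integral_setU//; exact: measurable_funTS.
rewrite (split f mf f0) (split _ mdv dv0) E1 E2; apply: leeD.
  apply: (le_trans left); apply: ge0_subset_integral => //.
  exact: measurable_funTS.
apply: (le_trans right); rewrite -integral_itv_obnd_cbnd; last exact: measurable_funTS.
apply: ge0_subset_integral => //; exact: measurable_funTS.
Qed.

Lemma open_interval_oo (I : set R) : open I -> is_interval I -> I !=set0 ->
  (exists M, forall t, I t -> `|t| < M) ->
  exists a b, a < b /\ I = `]a, b[%classic.
Proof.
move=> oI iI [x Ix] [M IM].
have lI : has_inf I.
  split; first by exists x.
  by exists (- M) => t /IM; rewrite ltr_norml => /andP[/ltW].
have uI : has_sup I.
  split; first by exists x.
  by exists M => t /IM; rewrite ltr_norml => /andP[_ /ltW].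
have near_I t : I t -> exists2 e, 0 < e & I (t - e) /\ I (t + e).
  move=> It; have /nbhs_ballP[e /= e0 eI] := open_nbhs_nbhs (conj oI It).
  exists (e / 2); first by rewrite divr_gt0.
  split; apply: eI; rewrite /ball/= opprD addrA subrr sub0r ?opprK ?normrN;
    by rewrite gtr0_norm ?divr_gt0// ltr_pdivrMr// ltr_pMr// ltr1n.
have Ioo t : I t -> inf I < t < sup I.
  move=> It; have [e e0 [I1 I2]] := near_I t It; apply/andP; split.
    by rewrite (@le_lt_trans _ _ (t - e)) ?ltrBlDr ?ltrDl//; apply: ge_inf => //; case: lI.
  by rewrite (@lt_le_trans _ _ (t + e)) ?ltrDl//; apply: ub_le_sup => //; case: uI.
exists (inf I), (sup I); split.
  by have /andP[/lt_trans] := Ioo x Ix; apply.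
apply/seteqP; split => t /=; rewrite in_itv/=; first exact: Ioo.
move=> /andP[it ts].
have [y Iy yt] := inf_lt lI.1 it.
have [z Iz tz] := sup_gt uI.1 ts.
by apply: (iI y z) => //; rewrite !ltW.
Qed.

(** S may be replaced by its bounded part T around the support K of v: shrinking
    S only increases the weight and shortens the intervals. Then T is a countable
    disjoint union of bounded open intervals, treated one by one; their endpoints
    lie outside T, hence outside K, so that v vanishes near them. *)
Lemma hardy_line S K v dv q : open S -> closed K -> K `<=` S ->
  (exists M, forall t, K t -> `|t| < M) -> (forall t, ~ K t -> v t = 0) ->
  (forall t, is_derive t 1 v (dv t)) -> continuous dv -> 0 <= q ->
  (forall a b, a < b -> `]a, b[ `<=` S ->
     q = 0 \/ q * ((b - a) / 2) < lamb_constant) ->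
  (\int[mu]_(t in S) ((v t ^+ 2)%:E * hardy_weight S q t) <=
   \int[mu]_(t in S) (dv t ^+ 2)%:E)%E.
Proof.
move=> oS cK KS [M KM] vK vE cdv q0 hS.
have cv : continuous v.
  by move=> t; apply/differentiable_continuous/derivable1_diffP; case: (vE t).
pose T := S `&` `]-M, M[%classic.
have oT : open T by apply: openI => //; exact: itv_open.
have TS : T `<=` S by exact: subIsetl.
have KT : K `<=` T by move=> t Kt; split; [exact: KS|rewrite /= in_itv/= -ltr_norml KM].
have mS := open_measurable oS; have mT := open_measurable oT.
have mdv : measurable_fun setT (fun t => (dv t ^+ 2)%:E).
  exact: measurable_sqr_continuous.
have dv0 t : (0 <= (dv t ^+ 2)%:E)%E by rewrite lee_fin sqr_ge0.
set f := fun t => ((v t ^+ 2)%:E * hardy_weight T q t)%E.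
have mf : measurable_fun setT f by exact: measurable_hardy_integrand.
have f0 t : (0 <= f t)%E by rewrite mule_ge0 ?hardy_weight_ge0// lee_fin sqr_ge0.
apply: (@le_trans _ _ (\int[mu]_(t in T) (dv t ^+ 2)%:E)%E); last first.
  by apply: ge0_subset_integral => //; exact: measurable_funTS.
apply: (@le_trans _ _ (\int[mu]_(t in T) f t)%E).
  have -> : (\int[mu]_(t in S) ((v t ^+ 2)%:E * hardy_weight S q t) =
      \int[mu]_(t in T) ((v t ^+ 2)%:E * hardy_weight S q t))%E.
    apply: integral_subset_zero => //.
    by move=> t _ nT; rewrite vK ?expr0n ?mul0e// => /KT.
  apply: ge0_le_integral => //.
  - by move=> t _; rewrite mule_ge0 ?hardy_weight_ge0// lee_fin sqr_ge0.
  - by apply: measurable_funTS; exact: measurable_hardy_integrand.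
  - exact: measurable_funTS.
  - by move=> t _; apply: lee_pmul; rewrite ?lee_fin ?sqr_ge0 ?hardy_weight_ge0 ?hardy_weightS.
pose I := open_disjoint_itv oT.
have oI k : open (I k) /\ is_interval (I k).
  by split; [exact: open_disjoint_itv_open|exact: open_disjoint_itv_is_interval].
have tI : trivIset setT I by exact: open_disjoint_itv_trivIset.
have TI : T = \bigcup_k I k by exact: open_disjoint_itv_bigcup.
have mI k : measurable (I k) by apply: open_measurable; case: (oI k).
rewrite TI ge0_integral_bigcup//; last by rewrite -TI; exact: measurable_funTS.
rewrite ge0_integral_bigcup//; last by rewrite -TI; exact: measurable_funTS.
apply: lee_nneseries => [k _ _|k _].
  by apply: integral_ge0.
have [->|/set0P I0] := eqVneq (I k) set0; first by rewrite !integral_set0.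
have [oIk iIk] := oI k.
have IT : I k `<=` T by rewrite TI; exact: bigcup_sup.
have [|a [b [ab IE]]] := open_interval_oo oIk iIk I0.
  by exists M => t /IT[_]; rewrite /= in_itv/= -ltr_norml.
have endpoint c : closure (I k) c -> ~ I k c -> ~ T c.
  move=> clc nIc; rewrite TI => -[j _ Ijc].
  have /clc[t [Ikt Ijt]] : nbhs c (I j).
    by apply: open_nbhs_nbhs; split => //; case: (oI j).
  have jk : j = k.
    by apply: tI => //; exists t.
  by apply: nIc; rewrite -jk.
rewrite IE; apply: hardy_interval => //.
- by rewrite -IE.
- have awayK c : closure (I k) c -> ~ I k c ->
      exists2 e, 0 < e & forall t, `|c - t| < e -> v t = 0.
    move=> clc nIc; have nKc : ~ K c by move=> /KT; exact: endpoint.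
    have : nbhs c (~` K) by apply: open_nbhs_nbhs; split => //; exact: closed_openC.
    by move=> /nbhs_ballP[e /= e0 eK]; exists e => // t te; apply: vK; apply: eK.
  have [||e1 e10 h1] := awayK a.
  + by rewrite IE; apply: closure_itvoo => //; rewrite lexx ltW.
  + by rewrite IE /= in_itv/= ltxx.
  have [||e2 e20 h2] := awayK b.
  + by rewrite IE; apply: closure_itvoo => //; rewrite lexx ltW.
  + by rewrite IE /= in_itv/= ltxx andbF.
  exists (Num.min e1 e2 / 2); first by rewrite divr_gt0// lt_min e10.
  have m1 : Num.min e1 e2 <= e1 by rewrite ge_min lexx.
  have m2 : Num.min e1 e2 <= e2 by rewrite ge_min lexx orbT.
  move=> t /andP[at_ tb] [h|h]; [apply: h1|apply: h2].
    by rewrite ltr0_norm ?subr_lt0//; lra.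
  by rewrite gtr0_norm ?subr_gt0//; lra.
- by apply: hS => //; rewrite -IE => t /IT; exact: TS.
Qed.

End hardy_interval.

(** * Borel sets of row vectors *)

Section rV_borel.
Context {R : realType}.

Lemma measurable_ball_rV n (x : 'rV[R]_n) e : measurable (ball x e).
Proof.
have [e0|e0] := ltP 0 e; last first.
  rewrite (_ : ball x e = set0) ?measurable0//.
  by apply/seteqP; split => // y [/lt_le_trans/(_ e0)]; rewrite ltxx.
rewrite (_ : ball x e = \bigcap_(i in [set: 'I_n])
    ((fun y : 'rV[R]_n => y 0 i : R) @^-1` ball (x 0 i) e)).
  apply: fin_bigcap_measurable => // i _; rewrite -[X in measurable X]setTI.
  by apply: measurable_coord => //; exact: measurable_ball.
apply/seteqP; split => y.
  by move=> [_ xy] i _; exact: xy.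
by move=> xy; split => // i j; rewrite ord1; exact: (xy j).
Qed.

Definition rational_ball n (p : 'rV[rat]_n * nat) : set 'rV[R]_n :=
  ball (map_mx ratr p.1 : 'rV[R]_n) p.2.+1%:R^-1.

(** Uniform in k, so that the same k serves for both factors of a product. *)
Lemma rational_ball_sub n (x : 'rV[R]_n) (e : R) : 0 < e ->
  exists k0, forall k, (k0 <= k)%N ->
    exists2 q, rational_ball (q, k) x & rational_ball (q, k) `<=` ball x e.
Proof.
move=> e0; have [k0 k0e] : exists k0, k0.+1%:R^-1 < e / 2.
  have e2 : 0 < e / 2 by rewrite divr_gt0.
  by have [k _ /(_ k (leqnn k))] := near_infty_natSinv_lt (PosNum e2); exists k.
exists k0 => k k0k; have {k0e}ke : (k.+1%:R^-1 : R) < e / 2.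
  by apply: le_lt_trans k0e; rewrite lef_pV2 ?posrE// ler_nat.
have k1 : 0 < (k.+1%:R^-1 : R) by rewrite invr_gt0.
have /choice[q qP] : forall i : 'I_n, exists q : rat, `|ratr q - x 0 i| < k.+1%:R^-1.
  move=> i; have [q] := @rat_in_itvoo R (x 0 i - k.+1%:R^-1) (x 0 i + k.+1%:R^-1)
    ltac:(by rewrite ltrBlDr -addrA ltrDl addr_gt0).
  by rewrite in_itv/= => qx; exists q; rewrite ltr_distl.
exists (\row_i q i).
  by split => //= i j; rewrite ord1 !mxE /ball/=; exact: qP.
move=> y [_ /= qy]; split => // i j; rewrite ord1 /ball/=.
have := qy 0 j; have := qP j; rewrite !mxE /ball/= => h1 h2.
rewrite -(subrKA (ratr (q j))) (le_lt_trans (ler_normD _ _))//.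
by rewrite (splitr e) ltrD// ?(lt_trans _ ke)// distrC.
Qed.

(** The product of the coordinate sigma-algebras contains the open sets because
    products of rational balls form a countable base. *)
Lemma measurable_open_rVX m n (A : set ('rV[R]_m * 'rV[R]_n)) :
  open A -> measurable A.
Proof.
move=> oA.
pose box (p : 'rV[rat]_m * 'rV[rat]_n * nat) : set ('rV[R]_m * 'rV[R]_n) :=
  rational_ball (p.1.1, p.2) `*` rational_ball (p.1.2, p.2).
rewrite (_ : A = \bigcup_p (if `[< box p `<=` A >] then box p else set0)).
  apply: countable_bigcupT_measurable => // p; case: asboolP => // _.
  by apply: measurableX; exact: measurable_ball_rV.
apply/seteqP; split => [[x y] Axy|xy [p _]]; last by case: asboolP => // pA /pA.
have /nbhs_ballP[e /= e0 eA] : nbhs (x, y) A by exact: open_nbhs_nbhs.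
have [k1 xk] := rational_ball_sub x e0; have [k2 yk] := rational_ball_sub y e0.
have [q1 q1x q1e] := xk _ (leq_maxl k1 k2).
have [q2 q2y q2e] := yk _ (leq_maxr k1 k2).
have boxA : box (q1, q2, maxn k1 k2) `<=` A.
  by move=> [x' y'] [/= /q1e h1 /q2e h2]; apply: eA; split.
by exists (q1, q2, maxn k1 k2) => //; rewrite asboolT.
Qed.

Lemma measurable_open_rV n (A : set 'rV[R]_n) : open A -> measurable A.
Proof.
move=> oA; pose f (x : 'rV[R]_n) : 'rV[R]_n * 'rV[R]_0 := (x, 0).
have mf : measurable_fun setT f by exact: measurable_fun_pair.
rewrite (_ : A = f @^-1` (fst @^-1` A)); last by [].
rewrite -[X in measurable X]setTI; apply: mf => //.
by apply: measurable_open_rVX; apply: open_comp => // x _; exact: cvg_fst.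
Qed.

Lemma measurable_continuous_rV n (f : 'rV[R]_n -> R) :
  continuous f -> measurable_fun setT f.
Proof.
move=> cf; apply: (measurability _ (RGenOInfty.measurableE R)).
move=> _ [_ [c ->] <-]; rewrite setTI; apply: measurable_open_rV.
by apply: open_comp => //; exact: rray_open.
Qed.

Lemma measurable_mulmx m n (Q : 'M[R]_(m, n)) :
  measurable_fun setT (fun x : 'rV[R]_m => x *m Q).
Proof.
apply: measurable_rVP => i; under eq_fun do rewrite mxE.
by apply: measurable_sum => j; apply: measurable_funM => //; exact: measurable_coord.
Qed.

Lemma measurable_rVD d (T : measurableType d) n (f g : T -> 'rV[R]_n) :
  measurable_fun setT f -> measurable_fun setT g ->
  measurable_fun setT (fun x => f x + g x).
Proof.
move=> mf mg; apply: measurable_rVP => i; under eq_fun do rewrite mxE.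
by apply: measurable_funD; exact: (measurableT_comp (measurable_coord i)).
Qed.

Lemma measurable_rVN d (T : measurableType d) n (f : T -> 'rV[R]_n) :
  measurable_fun setT f -> measurable_fun setT (fun x => - f x).
Proof.
move=> mf; apply: measurable_rVP => i; under eq_fun do rewrite mxE.
by apply: measurable_funN; exact: (measurableT_comp (measurable_coord i)).
Qed.

Lemma measurable_rVZ d (T : measurableType d) n (c : T -> R) (f : T -> 'rV[R]_n) :
  measurable_fun setT c -> measurable_fun setT f ->
  measurable_fun setT (fun x => c x *: f x).
Proof.
move=> mc mf; apply: measurable_rVP => i; under eq_fun do rewrite mxE.
by apply: measurable_funM => //; exact: (measurableT_comp (measurable_coord i)).
Qed.

End rV_borel.

(** * Orthogonal invariance of Lebesgue measure *)

Section lebesgue_rV_integral.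
Context {R : realType}.
Local Open Scope ereal_scope.
Let mu := @lebesgue_measure R.

Lemma integral_rV_cons n (f : 'rV[R]_n.+1 -> \bar R) :
  measurable_fun setT f -> (forall x, 0 <= f x) ->
  \int[lebesgue_rV n.+1]_x f x =
  \int[lebesgue_rV n]_y \int[mu]_s f (rV_cons (s, y)).
Proof.
move=> mf f0; rewrite (@ge0_integral_pushforward _ _ _ _ _ _ (@measurable_rV_cons R n)
  (mu \x lebesgue_rV n) setT f)//= preimage_setT.
by rewrite fubini_tonelli2//; exact: measurableT_comp (@measurable_rV_cons R n).
Qed.

Definition shiftR (c s : measurableTypeR R) : measurableTypeR R := (s + c)%R.

Lemma measurable_shiftR c : measurable_fun setT (shiftR c).
Proof. exact: measurable_funD. Qed.

Lemma integral_shift (f : R -> \bar R) c : measurable_fun setT f ->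
  (forall s, 0 <= f s) -> \int[mu]_s f (s + c)%R = \int[mu]_s f s.
Proof.
move=> mf f0.
pose m : {measure set (measurableTypeR R) -> \bar R} :=
  measure_function_pushforward__canonical__measure_function_Measure mu
    (measurable_shiftR c).
transitivity (\int[m]_s f s).
  by rewrite (ge0_integral_pushforward (measurable_shiftR c)).
apply: (@eq_measure_integral _ _ _ _ mu m) => A mA _; apply/esym.
apply: (@lebesgue_measure_unique _ m) => // X [[a b] _ <-].
rewrite /m /= /pushforward (_ : _ @^-1` _ = `](a - c)%R, (b - c)%R]%classic); last first.
  by apply/seteqP; split => s /=; rewrite !in_itv/= ltrBlDr lerBrDr.
rewrite /mu [LHS]lebesgue_measure_itv [RHS]lebesgue_measure_itv/= !lte_fin ltrD2r.
by case: ifPn => //= _; rewrite -!EFinB opprB addrA subrK.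
Qed.

Lemma rV_consD n (s c : R) (y a : 'rV[R]_n) :
  rV_cons ((s + c)%R, (y + a)%R) = (rV_cons (s, y) + rV_cons (c, a))%R.
Proof. by apply/rowP => i; rewrite [RHS]mxE !rV_consE; case: unlift => //= j; rewrite mxE. Qed.

Lemma rV_unconsK n : cancel (@rV_uncons R n) (@rV_cons R n).
Proof.
move=> x; apply/rowP => i; rewrite rV_consE /rV_uncons/=.
by case: unliftP => [j ->|->//]; rewrite mxE.
Qed.

(** One coordinate at a time, in the order in which the measure is built. *)
Lemma integral_rV_translate n (f : 'rV[R]_n -> \bar R) a : measurable_fun setT f ->
  (forall x, 0 <= f x) ->
  \int[lebesgue_rV n]_x f (x + a)%R = \int[lebesgue_rV n]_x f x.
Proof.
elim: n => [|n IH] in f a *; move=> mf f0.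
  by apply: eq_integral => x _; congr f; apply/rowP; case.
have mt : measurable_fun setT (fun x : 'rV[R]_n.+1 => f (x + a)%R).
  by apply: measurableT_comp => //; exact: measurable_rVD.
rewrite [LHS](integral_rV_cons mt (fun x => f0 _)) [RHS](integral_rV_cons mf f0).
have {1}-> : a = rV_cons (rV_uncons a) by rewrite rV_unconsK.
case: (rV_uncons a) => c b.
have m2 : measurable_fun setT (fun p : measurableTypeR R * 'rV[R]_n => f (rV_cons p)).
  by apply: measurableT_comp => //; exact: measurable_rV_cons.
rewrite -(IH (fun y => \int[mu]_s f (rV_cons (s, y))) b); last 2 first.
- exact: (measurable_fun_fubini_tonelli_G (fun p => f (rV_cons p))).
- by move=> y; exact: integral_ge0.
apply: eq_integral => y _.
rewrite -(@integral_shift (fun s => f (rV_cons (s, (y + b)%R))) c)//.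
  by apply: eq_integral => s _; rewrite rV_consD.
exact: (measurableT_comp m2 (pair2_measurable _)).
Qed.

Definition rV_box n (a b : R) :=
  [set x : 'rV[R]_n | forall i, (a < x 0%R i < b)%R].

Lemma measurable_rV_box n a b : measurable (@rV_box n a b).
Proof.
rewrite (_ : @rV_box n a b = \bigcap_(i in [set: 'I_n])
    ((fun y : 'rV[R]_n => y 0%R i : R) @^-1` `]a, b[)).
  apply: fin_bigcap_measurable => // i _; rewrite -[X in measurable X]setTI.
  exact: measurable_coord.
by apply/seteqP; split => y h i; have := h i; rewrite /= in_itv//=; apply.
Qed.

Lemma lebesgue_rV_box n (a b : R) : (a <= b)%R ->
  lebesgue_rV n (@rV_box n a b) = ((b - a) ^+ n)%:E.
Proof.
move=> ab; elim: n => [|n IH].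
  by rewrite expr0 /= diracE mem_set// => i; case: i.
rewrite /= /pushforward (_ : _ @^-1` _ = `]a, b[%classic `*` @rV_box n a b); last first.
  apply/seteqP; split => -[s y] /=.
    move=> h; split; first by have := h ord0; rewrite rV_consE unlift_none/= in_itv.
    by move=> i; have := h (lift ord0 i); rewrite rV_consE liftK.
  move=> [/= sab yab] i; rewrite rV_consE; case: unlift => /= [j|]; first exact: yab.
  by move: sab; rewrite in_itv.
rewrite product_measure1E//; last exact: measurable_rV_box.
rewrite [X in _ * X]IH exprS EFinM; congr (_ * _).
rewrite [LHS]lebesgue_measure_itv/= lte_fin -EFinB; case: ltP => // ba.
by have -> : b = a; [apply/le_anti; rewrite ba ab|rewrite subrr].
Qed.

End lebesgue_rV_integral.

Section euclidean_invariance.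
Context {R : realType}.
Local Open Scope ereal_scope.

Lemma enorm_mul n (x : 'rV[R]_n) : enorm x = Num.sqrt ((x *m x^T) 0%R 0%R).
Proof. by congr Num.sqrt; rewrite mxE; apply: eq_bigr => i _; rewrite mxE expr2. Qed.

Lemma enorm_orthogonal m n (Q : 'M[R]_(m, n)) (x : 'rV[R]_m) :
  (Q *m Q^T)%R = 1%:M%R -> enorm (x *m Q)%R = enorm x.
Proof.
by move=> QQ; rewrite !enorm_mul trmx_mul mulmxA -(mulmxA x) QQ mulmx1.
Qed.

Lemma enormN n (x : 'rV[R]_n) : enorm (- x)%R = enorm x.
Proof. by congr Num.sqrt; apply: eq_bigr => i _; rewrite mxE sqrrN. Qed.

Lemma ler_coord_enorm n (x : 'rV[R]_n) i : (`|x 0%R i| <= enorm x)%R.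
Proof.
rewrite -sqrtr_sqr /enorm ler_sqrt ?sumr_ge0// => [|j _]; last exact: sqr_ge0.
by rewrite (bigD1 i)//= lerDl sumr_ge0// => j _; exact: sqr_ge0.
Qed.

Lemma punctured_ball_gt0 n : (0 < n)%N -> 0 < lebesgue_rV n (@punctured_ball R n).
Proof.
case: n => // n _.
set e : R := (n.+1%:R^-1)%R.
have e0 : (0 < e)%R by rewrite invr_gt0.
(* a cube of side 1 / (n + 1) lies in the unit ball *)
apply: (@lt_le_trans _ _ (lebesgue_rV n.+1 (@rV_box R n.+1 0 e))).
  by rewrite lebesgue_rV_box ?ltW// subr0 lte_fin exprn_gt0.
apply: le_measure; rewrite ?inE; [exact: measurable_rV_box|exact: measurable_punctured_ball|].
move=> x xe; apply/andP; split.
  apply: lt_le_trans (ler_coord_enorm x ord0).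
  by rewrite normr_gt0 gt_eqF//; have /andP[] := xe ord0.
rewrite -[leRHS]sqrtr1 ler_sqrt//.
apply: (@le_trans _ _ (\sum_(i < n.+1) e)%R).
  apply: ler_sum => i _; have /andP[x0 xe1] := xe i.
  have e1 : (e <= 1)%R by rewrite invf_le1 ?ler1n.
  rewrite expr2 -[leRHS]mulr1.
  by apply: ler_pM; rewrite ?ltW// (lt_le_trans xe1).
by rewrite sumr_const card_ord -mulr_natl mulfV.
Qed.

Lemma punctured_ball_lty n : lebesgue_rV n (@punctured_ball R n) < +oo.
Proof.
apply: (@le_lt_trans _ _ (lebesgue_rV n (@rV_box R n (-2) 2))); last first.
  by rewrite lebesgue_rV_box ?ltry//; lra.
apply: le_measure; rewrite ?inE; [exact: measurable_punctured_ball|exact: measurable_rV_box|].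
move=> x /andP[_ x1] i; rewrite -ltr_norml.
by rewrite (le_lt_trans (ler_coord_enorm x i))// (le_lt_trans x1)// ltr1n.
Qed.

(** Comparing a rotated copy of Lebesgue measure with Lebesgue measure itself:
    both are translation invariant, and both give the same finite nonzero mass to
    the symmetric set B, so that Tonelli's theorem applied to f(xQ + y) 1_B(y)
    identifies them. *)
Lemma integral_rV_orthogonal n (Q : 'M[R]_n) (f : 'rV[R]_n -> \bar R) :
  (0 < n)%N ->
  (Q *m Q^T)%R = 1%:M%R -> measurable_fun setT f -> (forall x, 0 <= f x) ->
  \int[lebesgue_rV n]_x f (x *m Q)%R = \int[lebesgue_rV n]_x f x.
Proof.
move=> n0 QQ mf f0; have QQ' : (Q^T *m Q)%R = 1%:M%R by exact: mulmx1C.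
set lam := lebesgue_rV n.
pose B := @punctured_ball R n.
have mB : measurable B by exact: measurable_punctured_ball.
pose g (y : 'rV[R]_n) : \bar R := (\1_B y)%:E.
have mg : measurable_fun setT g by apply/measurable_EFinP; exact: measurable_indic.
have g0 y : 0 <= g y by rewrite lee_fin.
have intg : \int[lam]_y g y = lam B by rewrite integral_indic// setIT.
(* B is invariant under Q and under the reflection in the origin *)
have gQ x y : g (y - x *m Q)%R = g (x - y *m Q^T)%R.
  congr ((_)%:E); rewrite !indicE; congr ((_ : bool)%:R).
  have E : enorm (y - x *m Q)%R = enorm (x - y *m Q^T)%R.
    rewrite -[LHS](@enorm_orthogonal _ _ Q^T%R) ?trmxK// mulmxBl -mulmxA QQ mulmx1.
    by rewrite -enormN opprB.
  by apply/idP/idP; rewrite !inE /B /punctured_ball/= E.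
move: (g) mg g0 intg gQ => {}g mg g0 intg gQ.
have B0 := punctured_ball_gt0 n0; have Boo := punctured_ball_lty n.
have BE : lam B = (fine (lam B))%:E by rewrite fineK// ge0_fin_numE.
have mfQ : measurable_fun setT (fun x => f (x *m Q)%R).
  by apply: measurableT_comp => //; exact: measurable_mulmx.
suff : (\int[lam]_x f (x *m Q)%R) * lam B = (\int[lam]_x f x) * lam B.
  have Bfin : lam B \is a fin_num by rewrite BE.
  move=> E; apply/eqP; rewrite eq_le -(lee_pmul2r Bfin B0).
  by rewrite -[X in _ && X](lee_pmul2r Bfin B0) E lexx.
pose T := ('rV[R]_n * 'rV[R]_n)%type.
have mxQ : measurable_fun setT (fun p : T => (p.1 *m Q)%R).
  apply: (@measurableT_comp _ _ _ _ _ _ (fun x : 'rV[R]_n => x *m Q)).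
    exact: measurable_mulmx.
  exact: measurable_fst.
rewrite -intg -ge0_integralZl//; last exact: integral_ge0.
transitivity (\int[lam]_y \int[lam]_x (f (x *m Q + y)%R * g y)).
  apply: eq_integral => y _; rewrite ge0_integralZr//; last first.
    by apply: measurableT_comp => //; apply: measurable_rVD => //; exact: measurable_mulmx.
  rewrite -(integral_rV_translate (y *m Q^T)%R mfQ)//; congr (_ * _).
  by apply: eq_integral => x _; rewrite mulmxDl -mulmxA QQ' mulmx1.
rewrite -(fubini_tonelli (fun p : T => f (p.1 *m Q + p.2)%R * g p.2)); last 2 first.
- apply: emeasurable_funM; last exact: (measurableT_comp mg measurable_snd).
  by apply: measurableT_comp => //; exact: measurable_rVD.
- by move=> p; rewrite mule_ge0.
transitivity (\int[lam]_x \int[lam]_y (f y * g (y - x *m Q)%R)).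
  apply: eq_integral => x _ /=.
  rewrite -(@integral_rV_translate _ n (fun y => f y * g (y - x *m Q)%R) (x *m Q)%R).
  - by apply: eq_integral => y _; rewrite addrK addrC.
  - apply: emeasurable_funM => //; apply: measurableT_comp => //.
    exact: measurable_rVD.
  - by move=> y; rewrite mule_ge0.
rewrite (fubini_tonelli (fun p : T => f p.2 * g (p.2 - p.1 *m Q)%R)); last 2 first.
- apply: emeasurable_funM; first exact: (measurableT_comp mf measurable_snd).
  apply: measurableT_comp => //; apply: measurable_rVD => //.
  exact: measurable_rVN.
- by move=> p; rewrite mule_ge0.
rewrite -ge0_integralZr//; last exact: integral_ge0.
apply: eq_integral => y _ /=.
rewrite ge0_integralZl//; last first.
  apply: measurableT_comp => //; apply: measurable_rVD => //.
  by apply: measurable_rVN; exact: measurable_mulmx.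
congr (_ * _).
under eq_integral do rewrite gQ.
exact: (integral_rV_translate (- (y *m Q^T))%R mg g0).
Qed.

End euclidean_invariance.

(** * Orthonormal frames and means over the sphere *)

Section orthogonal_frames.
Context {R : realType}.

Definition dot n (x y : 'rV[R]_n) : R := (x *m y^T) 0 0.

Lemma dotE n (x y : 'rV[R]_n) : dot x y = \sum_i x 0 i * y 0 i.
Proof. by rewrite /dot mxE; apply: eq_bigr => i _; rewrite mxE. Qed.

Lemma mulmx_dot n (x y : 'rV[R]_n) : x *m y^T = (dot x y)%:M.
Proof. by apply/matrixP => i j; rewrite !ord1 [RHS]mxE eqxx mulr1n. Qed.

Lemma dotC n (x y : 'rV[R]_n) : dot x y = dot y x.
Proof. by rewrite !dotE; apply: eq_bigr => i _; rewrite mulrC. Qed.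

Lemma dot_ge0 n (x : 'rV[R]_n) : 0 <= dot x x.
Proof. by rewrite dotE sumr_ge0// => i _; rewrite -expr2 sqr_ge0. Qed.

Lemma sqr_enorm n (x : 'rV[R]_n) : enorm x ^+ 2 = dot x x.
Proof. by rewrite enorm_mul sqr_sqrtr// dot_ge0. Qed.

Lemma dot_eq0 n (x : 'rV[R]_n) : dot x x = 0 -> x = 0.
Proof.
rewrite dotE => /eqP; rewrite psumr_eq0 => [/allP x0|i _]; last by rewrite -expr2 sqr_ge0.
apply/rowP => i; have := x0 i (mem_index_enum _).
by rewrite -expr2 sqrf_eq0 mxE => /eqP.
Qed.

Lemma dotBl n (x y z : 'rV[R]_n) : dot (x - y) z = dot x z - dot y z.
Proof. by rewrite !dotE -sumrB; apply: eq_bigr => i _; rewrite !mxE mulrBl. Qed.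

Lemma dotBr n (x y z : 'rV[R]_n) : dot x (y - z) = dot x y - dot x z.
Proof. by rewrite ![dot x _]dotC dotBl. Qed.

Lemma dot_orthogonal n (Q : 'M[R]_n) (x y : 'rV[R]_n) :
  dot (x *m Q) y = dot x (y *m Q^T).
Proof. by rewrite /dot trmx_mul trmxK mulmxA. Qed.

(** Householder's reflection in the hyperplane bisecting x and y. *)
Lemma householder n (x y : 'rV[R]_n) : dot x x = dot y y ->
  exists2 Q : 'M[R]_n, Q *m Q^T = 1%:M & x *m Q = y.
Proof.
move=> xy; have [->|v0] := eqVneq x y.
  by exists 1%:M; rewrite ?trmx1 mulmx1.
pose v := x - y; pose c := dot v v.
have c0 : c != 0.
  by apply: contra v0 => /eqP/dot_eq0/eqP; rewrite subr_eq0.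
have vv : v *m v^T = c%:M by exact: mulmx_dot.
have cE : c = 2 * dot x v.
  by rewrite /c /v !dotBl !dotBr -xy (dotC y x); ring.
pose P := v^T *m v; pose k := 2 / c.
have PT : P^T = P by rewrite trmx_mul trmxK.
have PP : P *m P = c *: P.
  by rewrite /P mulmxA -(mulmxA _ v) vv mul_mx_scalar -scalemxAl.
exists (1%:M - k *: P).
  have -> : (1%:M - k *: P)^T = 1%:M - k *: P by rewrite linearB/= linearZ/= trmx1 PT.
  rewrite mulmxBl !mulmxBr !mulmx1 mul1mx.
  rewrite -scalemxAl -scalemxAr PP !scalerA opprB addrA -(addrA 1%:M).
  rewrite (_ : k * k * c = k + k); last by rewrite /k; field.
  by rewrite scalerDl; apply/matrixP => i j; rewrite !mxE; ring.
rewrite mulmxBr mulmx1 -scalemxAr /P mulmxA mulmx_dot mul_scalar_mx scalerA.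
have kd : k * dot x v = 1.
  have -> : dot x v = c / 2 by rewrite cE; field.
  by rewrite /k; field.
by rewrite kd scale1r /v opprB addrC subrK.
Qed.

(** Some frame exists: take the last rows of an orthogonal matrix whose first row
    is nu, as given by a reflection that exchanges nu and the first basis
    vector. *)
Lemma hyperplane_frameP m (nu : 'rV[R]_m.+1) : enorm nu = 1 ->
  hyperplane_frame nu *m (hyperplane_frame nu)^T = 1%:M /\
  hyperplane_frame nu *m nu^T = 0.
Proof.
move=> nu1; pose e : 'rV[R]_(1 + m) := row_mx 1%:M 0.
have [|Q QQ eQ] := @householder m.+1 e nu.
  rewrite -[RHS]sqr_enorm nu1 expr1n /dot /e.
  by rewrite (@tr_row_mx _ 1 1 m) (@mul_row_col _ 1 1 m 1) trmx1 mulmx1 mul0mx addr0 mxE.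
apply: (@xgetPex _ 0 [set B : 'M[R]_(m.+1.-1, m.+1) | (B *m B^T = 1%:M /\ B *m nu^T = 0)%R]).
pose Q' : 'M[R]_(1 + m, m.+1) := Q.
exists (dsubmx Q').
have : col_mx (usubmx Q') (dsubmx Q') *m (col_mx (usubmx Q') (dsubmx Q'))^T = 1%:M.
  by rewrite vsubmxK.
rewrite tr_col_mx mul_col_row (scalar_mx_block 1) => /eq_block_mx[_ _ h1 h2].
split => //=; rewrite -eQ.
have -> : (e *m Q : 'rV_m.+1) = usubmx Q'.
  by rewrite -[LHS]/(e *m Q') -[in LHS](vsubmxK Q') mul_row_col mul1mx mul0mx addr0.
exact: h1.
Qed.

Definition line_frame m (nu : 'rV[R]_m.+1) : 'M[R]_m.+1 :=
  col_mx nu (hyperplane_frame nu : 'M[R]_(m, m.+1)).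

Lemma line_frame_orthogonal m (nu : 'rV[R]_m.+1) : enorm nu = 1 ->
  line_frame nu *m (line_frame nu)^T = 1%:M.
Proof.
move=> nu1; have [FF Fnu] := hyperplane_frameP nu1.
rewrite /line_frame (@tr_col_mx _ 1 m m.+1) (@mul_col_row _ 1 m m.+1 1 m).
transitivity (block_mx 1%:M 0 0 1%:M : 'M[R]_(1 + m)); last first.
  by rewrite -scalar_mx_block.
have nn : nu *m nu^T = 1%:M by rewrite mulmx_dot -sqr_enorm nu1 expr1n.
have nF : nu *m (hyperplane_frame nu)^T = 0.
  by apply: trmx_inj; rewrite trmx_mul trmxK trmx0.
by rewrite nn nF FF Fnu.
Qed.

End orthogonal_frames.

Section sphere_integral.
Context {R : realType}.
Local Open Scope ereal_scope.

(** Tonelli's theorem in the orthonormal coordinates adapted to nu. *)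
Lemma integral_lines m (nu : 'rV[R]_m.+1) (f : 'rV[R]_m.+1 -> \bar R) :
  enorm nu = 1%R -> measurable_fun setT f -> (forall x, 0 <= f x) ->
  \int[lebesgue_rV m.+1]_x f x =
  \int[lebesgue_rV m]_y \int[lebesgue_measure]_s
    f (y *m hyperplane_frame nu + s *: nu)%R.
Proof.
move=> nu1 mf f0.
rewrite -(@integral_rV_orthogonal R m.+1 (line_frame nu) f isT)//; last first.
  exact: line_frame_orthogonal.
have mfQ : measurable_fun setT (fun x => f (x *m line_frame nu)%R).
  by apply: measurableT_comp => //; exact: measurable_mulmx.
rewrite (integral_rV_cons mfQ (fun x => f0 _)).
apply: eq_integral => y _; apply: eq_integral => s _; congr f.
by rewrite /rV_cons /line_frame (@mul_row_col _ 1 1 m m.+1) mul_scalar_mx addrC.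
Qed.

Section sphere.
Variable n : nat.
Notation sigma := (@sphere_measure R n).
Notation lam := (lebesgue_rV n).
Notation B := (@punctured_ball R n).

Let fin_sphere : fin_num_fun sigma.
Proof.
move=> A mA; rewrite ge0_fin_numE ?measure_ge0//.
rewrite /sphere_measure lte_mul_pinfty ?lee_fin ?invr_ge0 ?fine_ge0//.
apply: (le_lt_trans _ (punctured_ball_lty n)); apply: le_measure; rewrite ?inE.
- apply: measurableI; first exact: measurable_punctured_ball.
  by rewrite -[X in measurable X]setTI; exact: measurable_direction.
- exact: measurable_punctured_ball.
- exact: subIsetl.
Qed.

HB.instance Definition _ := Measure_isFinite.Build _ _ _ sigma fin_sphere.

Hypothesis n0 : (0 < n)%N.

Lemma sphere_measureT : sigma setT = 1.
Proof.
rewrite /sphere_measure preimage_setT setIT.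
have B0 := @punctured_ball_gt0 R _ n0; have Boo := @punctured_ball_lty R n.
rewrite -[X in _ * X]fineK ?ge0_fin_numE// -EFinM mulVf// gt_eqF// fine_gt0//.
by rewrite B0.
Qed.

Lemma measurable_sphere : measurable (@sphere R n).
Proof.
rewrite (_ : @sphere R n = @enorm R n @^-1` [set 1%R]); last by [].
by rewrite -[X in measurable X]setTI; exact: measurable_enorm.
Qed.

Lemma enormZ (a : R) (x : 'rV[R]_n) : enorm (a *: x)%R = (`|a| * enorm x)%R.
Proof.
rewrite /enorm (eq_bigr (fun i => a ^+ 2 * x 0%R i ^+ 2)%R); last first.
  by move=> i _; rewrite mxE exprMn.
by rewrite -mulr_sumr sqrtrM ?sqr_ge0// sqrtr_sqr.
Qed.

Lemma sphere_measureC : sigma (~` @sphere R n) = 0.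
Proof.
rewrite /sphere_measure (_ : _ `&` _ = set0) ?measure0 ?mule0//.
apply/seteqP; split => // x [/andP[x0 _]]; apply.
by rewrite /sphere/= /direction enormZ ger0_norm ?invr_ge0 ?ltW// mulVf// gt_eqF.
Qed.

Lemma integral_sphere (f : 'rV[R]_n -> \bar R) : measurable_fun setT f ->
  (forall x, 0 <= f x) ->
  \int[sigma]_(nu in @sphere R n) f nu = \int[sigma]_nu f nu.
Proof.
move=> mf f0; rewrite [RHS](@ge0_negligible_integral _ _ _ _ _ (~` @sphere R n))//.
- by rewrite setDE setCK setTI.
- by apply: measurableC; exact: measurable_sphere.
- exact: sphere_measureC.
Qed.

Lemma sphere_measure_orthogonal (Q : 'M[R]_n) (A : set 'rV[R]_n) :
  (Q *m Q^T)%R = 1%:M%R -> measurable A ->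
  sigma ((fun x => x *m Q)%R @^-1` A) = sigma A.
Proof.
move=> QQ mA; rewrite /sphere_measure; congr (_ * _).
have mBA : measurable (B `&` @direction R n @^-1` A).
  apply: measurableI; first exact: measurable_punctured_ball.
  by rewrite -[X in measurable X]setTI; exact: measurable_direction.
have -> : B `&` @direction R n @^-1` ((fun x => x *m Q)%R @^-1` A) =
  (fun x => x *m Q)%R @^-1` (B `&` @direction R n @^-1` A).
  apply/seteqP; split => x;
    by rewrite /punctured_ball /direction/= enorm_orthogonal// scalemxAl.
set C := B `&` _ in mBA *.
have mI : measurable_fun setT (fun x => (\1_C x)%:E : \bar R).
  by apply/measurable_EFinP; exact: measurable_indic.
have mQC : measurable ((fun x => x *m Q)%R @^-1` C).
  by rewrite -[X in measurable X]setTI; exact: measurable_mulmx.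
have lamE D : measurable D -> lam D = \int[lam]_x (\1_D x)%:E.
  by move=> mD; rewrite integral_indic// setIT.
rewrite [LHS]lamE// [RHS]lamE//.
rewrite -[RHS](integral_rV_orthogonal n0 QQ mI (fun x => ltac:(by rewrite lee_fin))).
by apply: eq_integral => x _; rewrite !indicE; congr ((_ : bool)%:R%:E).
Qed.

Lemma integral_sphere_orthogonal (Q : 'M[R]_n) (f : 'rV[R]_n -> \bar R) :
  (Q *m Q^T)%R = 1%:M%R -> measurable_fun setT f -> (forall x, 0 <= f x) ->
  \int[sigma]_nu f (nu *m Q)%R = \int[sigma]_nu f nu.
Proof.
move=> QQ mf f0.
pose m : {measure set 'rV[R]_n -> \bar R} :=
  measure_function_pushforward__canonical__measure_function_Measure sigma
    (measurable_mulmx Q).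
transitivity (\int[m]_nu f nu).
  by rewrite (ge0_integral_pushforward (measurable_mulmx Q)).
apply: (@eq_measure_integral _ _ _ _ sigma m) => A mA _.
exact: sphere_measure_orthogonal.
Qed.

Lemma measurable_dot (g : 'rV[R]_n) : measurable_fun setT (fun nu : 'rV[R]_n => dot nu g).
Proof.
under eq_fun do rewrite dotE.
by apply: measurable_sum => j; apply: measurable_funM => //; exact: measurable_coord.
Qed.

Lemma integral_sphere_dot_eq (g h : 'rV[R]_n) : dot g g = dot h h ->
  \int[sigma]_nu (dot nu g ^+ 2)%:E = \int[sigma]_nu (dot nu h ^+ 2)%:E.
Proof.
move=> gh; have [Q QQ gQ] := householder gh.
rewrite -[RHS](integral_sphere_orthogonal (Q := Q)) => [|||x].
- apply: eq_integral => nu _; rewrite dot_orthogonal -gQ -mulmxA QQ mulmx1//.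
- exact: QQ.
- by apply/measurable_EFinP/measurable_funX; exact: measurable_dot.
- by rewrite lee_fin sqr_ge0.
Qed.

(** By symmetry the second moment of the direction is isotropic, so g may be
    replaced by |g| times any basis vector; the n integrals so obtained are equal
    and their sum is the integral of |g|^2 |nu|^2 = |g|^2. *)
Lemma integral_sphere_dot (g : 'rV[R]_n) :
  n%:R%:E * \int[sigma]_nu (dot nu g ^+ 2)%:E = (enorm g ^+ 2)%:E.
Proof.
have d i : dot (enorm g *: delta_mx 0 i)%R (enorm g *: delta_mx 0 i : 'rV[R]_n)%R = dot g g.
  rewrite dotE (bigD1 i)//= big1 => [|j ji]; rewrite !mxE ?eqxx/= ?(negbTE ji) ?mulr0 ?mul0r//.
  by rewrite mulr1 addr0 -expr2 sqr_enorm.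
have mdelta i nu : (dot nu (enorm g *: delta_mx 0 i : 'rV[R]_n)%R = enorm g * nu 0 i)%R.
  rewrite dotE (bigD1 i)//= big1 => [|j ji]; rewrite !mxE ?eqxx/= ?(negbTE ji) ?mulr0//.
  by rewrite mulr1 addr0 mulrC.
transitivity (\sum_(i < n) \int[sigma]_nu (dot nu (enorm g *: delta_mx 0 i)%R ^+ 2)%:E).
  rewrite (eq_bigr (fun=> \int[sigma]_nu (dot nu g ^+ 2)%:E)); last first.
    by move=> i _; apply: integral_sphere_dot_eq.
  by rewrite sumr_const card_ord; exact: mule_natl.
rewrite -ge0_integral_sum//; last first.
- by move=> i nu _; rewrite lee_fin sqr_ge0.
- by move=> i; apply/measurable_EFinP/measurable_funX; exact: measurable_dot.
rewrite -integral_sphere; last 2 first.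
- apply: emeasurable_sum => i.
  by apply/measurable_EFinP/measurable_funX; exact: measurable_dot.
- by move=> nu; rewrite sume_ge0// => i _; rewrite lee_fin sqr_ge0.
rewrite (eq_integral (fun=> (enorm g ^+ 2)%:E)) => [|nu /set_mem nu1].
  rewrite integral_cst//; last exact: measurable_sphere.
  rewrite [X in _ * X](_ : _ = 1) ?mule1//.
  rewrite -sphere_measureT -(setUv (@sphere R n)) measureU//; last first.
  - by rewrite setICr.
  - by apply: measurableC; exact: measurable_sphere.
  - exact: measurable_sphere.
  by rewrite [X in _ + X](_ : _ = 0) ?adde0//; exact: sphere_measureC.
rewrite sumEFin; congr EFin; under eq_bigr do rewrite mdelta exprMn.
rewrite -mulr_sumr -(sqr_sqrtr (a := \sum_i _)%R) ?sumr_ge0// => [|i _].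
  by rewrite -/(enorm nu) nu1 expr1n mulr1.
exact: sqr_ge0.
Qed.

End sphere.
End sphere_integral.

(** * The directional distance and derivatives along lines *)

Section rho_measurable.
Context {R : realType}.
Variables (n : nat) (Omega : set 'rV[R]_n).
Hypothesis oOmega : open Omega.

Definition segment_inside (t : R) : set ('rV[R]_n * 'rV[R]_n) :=
  [set p | forall s, - t <= s <= t -> Omega (p.2 + s *: p.1)].

(** By compactness of the segment, Omega being open. *)
Lemma open_segment_inside t : open (segment_inside t).
Proof.
rewrite openE => p pt.
have /compact_near_coveringP/(_ _ (nbhs p)
  (fun q s => Omega (q.2 + s *: q.1)) _) := @segment_compact R (- t) t.
move=> h; rewrite /interior /segment_inside/=.
have : \near p, `[- t, t]%classic `<=` (fun s => Omega (p.2 + s *: p.1)).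
  apply: h => s; rewrite /= in_itv/= => st.
  pose F (sq : R * ('rV[R]_n * 'rV[R]_n)) := sq.2.2 + sq.1 *: sq.2.1.
  have cF : {for (s, p), continuous F}.
    apply: cvgD; first by apply: cvg_comp cvg_snd _; exact: cvg_snd.
    by apply: cvgZ; [exact: cvg_fst|apply: cvg_comp cvg_snd _; exact: cvg_fst].
  have := cF Omega (open_nbhs_nbhs (conj oOmega (pt s st))).
  by [].
apply: filterS => q qt s st; apply: qt.
by rewrite /= in_itv.
Qed.

(** rho_nu(x) < c means that for some rational r < c the segment of half-length r
    about x leaves Omega. *)
Lemma measurable_rho :
  measurable_fun setT (fun p : 'rV[R]_n * 'rV[R]_n => rho Omega p.1 p.2).
Proof.
apply: (measurability _ (ErealGenInftyO.measurableE R)) => _ [_ [c ->] <-].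
rewrite setTI.
pose G (r : rat) : set ('rV[R]_n * 'rV[R]_n) :=
  if ratr r < c then ~` segment_inside (ratr r) else set0.
rewrite (_ : _ @^-1` _ = \bigcup_r G r).
  apply: bigcupT_measurable_rat => r; rewrite /G; case: ifPn => // _.
  by apply: measurableC; apply: measurable_open_rVX; exact: open_segment_inside.
apply/seteqP; split => p /=.
  rewrite in_itv/= => /ereal_inf_lt[_ [s /= nO <-]]; rewrite lte_fin => sc.
  have [r] := rat_in_itvoo sc; rewrite in_itv/= => /andP[sr rc].
  exists r => //; rewrite /G rc => h; apply: nO; apply: h.
  by rewrite -ler_norml ltW.
move=> [r _]; rewrite /G; case: ifPn => // rc /existsNP[s /not_implyP[sr nO]].
rewrite in_itv/=; apply/ereal_inf_ltP; exists `|s|%:E; first by exists s.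
by rewrite lte_fin (le_lt_trans _ rc)// ler_norml.
Qed.

Lemma rho_ge0 nu x : (0 <= rho Omega nu x)%E.
Proof. by apply: le_ereal_inf_tmp => _ [s _ <-]; rewrite lee_fin. Qed.

Lemma rho_line nu x t :
  rho Omega nu (x + t *: nu) = line_dist [set s | Omega (x + s *: nu)] t.
Proof.
by congr ereal_inf; apply/seteqP; split => _ [s /= h <-]; exists s => //=;
   move: h; rewrite scalerDl addrA.
Qed.

End rho_measurable.

Section directional_derivative.
Context {R : realType} {V : normedModType R}.
Implicit Types (f : V -> R) (x v e : V).

Lemma is_derive_line f x v (t : R) : derivable f (x + t *: v) v ->
  is_derive t 1 (fun s => f (x + s *: v)) ('D_v f (x + t *: v)).
Proof.
move=> df.
have E : (fun h : R => h^-1 *: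
      (((fun s => f (x + s *: v)) \o shift t) (h *: 1) - f (x + t *: v))) =
    (fun h : R => h^-1 *: ((f \o shift (x + t *: v)) (h *: v) - f (x + t *: v))).
  apply/funext => h /=; congr (_ *: (f _ - _)).
  by rewrite [h *: 1]mulr1 scalerDl addrCA.
split; first by rewrite /derivable E.
by rewrite /derive E.
Qed.

Lemma line_mean_value f x e (d : R) : (forall y, derivable f y e) ->
  exists2 th : R, `|th| <= `|d| &
    f (x + d *: e) - f x = d * 'D_e f (x + th *: e).
Proof.
move=> df; pose g s := f (x + s *: e).
have dg (t : R) : is_derive t 1 g ('D_e f (x + t *: e)) by exact: is_derive_line.
have cg (a b : R) : {within `[a, b], continuous g}.
  apply: continuous_subspaceT => t; apply/differentiable_continuous.
  by apply/derivable1_diffP; case: (dg t).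
have [d0|d0] := leP 0 d.
  have [th] := MVT_segment d0 (fun t _ => dg t) (cg _ _).
  rewrite in_itv/= => /andP[t0 td]; rewrite /g scale0r addr0 subr0 mulrC => E.
  by exists th => //; rewrite !ger0_norm.
have [th] := MVT_segment (ltW d0) (fun t _ => dg t) (cg _ _).
rewrite in_itv/= => /andP[t0 td]; rewrite /g scale0r addr0 sub0r => E.
exists th; first by rewrite !ler0_norm ?lerN2// ltW.
by rewrite -opprB E mulrN opprK mulrC.
Qed.

(** Only the derivative along e has to be continuous: by the mean value theorem
    its values at the intermediate points converge. *)
Lemma is_derive_dirD f x v e (c : R) : derivable f x v ->
  (forall y, derivable f y e) -> {for x, continuous ('D_e f)} ->
  is_derive x (v + c *: e) f ('D_v f x + c * 'D_e f x).
Proof.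
move=> dv de ce.
have /choice[th thP] : forall h : R, exists th : R, `|th| <= `|h * c| /\
    f (x + h *: v + (h * c) *: e) - f (x + h *: v) =
    h * c * 'D_e f (x + h *: v + th *: e).
  by move=> h; have [th t1 t2] := line_mean_value (x + h *: v) (h * c) de; exists th.
have zx : x + h *: v + th h *: e @[h --> (0 : R)^'] --> x.
  rewrite -[X in _ --> X]addr0 -[X in _ --> X + _]addr0.
  have h0 : h @[h --> (0 : R)^'] --> (0 : R).
    by apply: cvg_within_filter; exact: cvg_id.
  apply: cvgD; first apply: cvgD; first exact: cvg_cst.
    by rewrite -(scale0r v); apply: cvgZr_tmp.
  rewrite -(scale0r e); apply: cvgZr_tmp.
  apply/cvgr0Pnorm_lt => eps eps0.
  have c1 : 0 < eps / (`|c| + 1) by rewrite divr_gt0// ltr_pwDr.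
  have /cvgr0Pnorm_lt/(_ _ c1) := h0; apply: filterS => h hlt.
  rewrite (le_lt_trans (thP h).1)// normrM.
  rewrite ltr_pdivlMr ?ltr_pwDr// in hlt.
  by rewrite (le_lt_trans _ hlt)// ler_wpM2l// lerDl.
have De : 'D_e f (x + h *: v + th h *: e) @[h --> (0 : R)^'] --> 'D_e f x.
  exact: (cvg_comp _ _ zx ce).
have Dv : h^-1 *: ((f \o shift x) (h *: v) - f x) @[h --> (0 : R)^'] --> 'D_v f x by exact: dv.
have L : h^-1 *: ((f \o shift x) (h *: (v + c *: e)) - f x) @[h --> (0 : R)^'] -->
    'D_v f x + c * 'D_e f x.
  have := cvgD Dv (cvgM (cvg_cst c) De) => /(_ _ _ _).
  apply: cvg_trans; apply: near_eq_cvg; near=> h.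
  have h0 : h != 0 by near: h; exact: nbhs_dnbhs_neq.
  have E := (thP h).2; rewrite /= -[RHS]/(_ * _).
  rewrite -[LHS]/(h^-1 * (f (h *: v + x) - f x) +
    c * 'D_e f (x + h *: v + th h *: e)).
  have -> : h *: (v + c *: e) + x = x + h *: v + (h * c) *: e.
    by rewrite scalerDr scalerA addrC addrA.
  rewrite (addrC _ x).
  rewrite -(subrK (f (x + h *: v)) (f (x + h *: v + (h * c) *: e))) E.
  by move: ('D_e f _) (f _) (f x) => a b d; field.
split; first by apply/cvg_ex; eexists; exact: L.
exact: cvg_lim L.
Unshelve. all: by end_near. Qed.

End directional_derivative.

Section gradient.
Context {R : realType}.
Variable n : nat.
Implicit Types (phi : 'rV[R]_n -> R).

Definition grad phi x : 'rV[R]_n := \row_i partial i phi x.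

(** Directional derivatives are computed from the continuous partial derivatives
    by adding one coordinate at a time. *)
Lemma is_derive_grad phi x nu : (forall i y, derivable phi y (delta_mx 0 i)) ->
  (forall i, continuous (partial i phi)) ->
  is_derive x nu phi (dot nu (grad phi x)).
Proof.
move=> dphi cphi.
have H (r : seq 'I_n) : is_derive x (\sum_(i <- r) nu 0 i *: delta_mx 0 i) phi
    (\sum_(i <- r) nu 0 i * partial i phi x).
  elim: r => [|i r IH]; first by rewrite !big_nil; exact: is_derive0.
  rewrite !big_cons addrC [X in is_derive _ _ _ X]addrC.
  have := @is_derive_dirD _ _ phi x _ (delta_mx 0 i) (nu 0 i) (@ex_derive _ _ _ _ _ _ _ IH)
    (dphi i) (cphi i x).
  by rewrite (@derive_val _ _ _ _ _ _ _ IH).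
have := H (index_enum 'I_n); rewrite -row_sum_delta.
by congr (is_derive _ _ _); rewrite dotE; apply: eq_bigr => i _; rewrite mxE.
Qed.

End gradient.

(** * The inequality for test functions *)

Section directional_hardy.
Context {R : realType}.
Local Open Scope ereal_scope.

Definition directional_weight n (Omega : set 'rV[R]_n) (q : R) nu x : \bar R :=
  4^-1%:E * (rho Omega nu x ^+ 2)^-1 + (q ^+ 2)%:E.

Lemma directional_weight_line n (Omega : set 'rV[R]_n) (q : R) nu x t :
  directional_weight Omega q nu (x + t *: nu)%R =
  hardy_weight [set s | Omega (x + s *: nu)%R] q t.
Proof. by rewrite /directional_weight rho_line. Qed.

Lemma directional_weight_ge0 n (Omega : set 'rV[R]_n) q nu x :
  0 <= directional_weight Omega q nu x.
Proof.
by rewrite adde_ge0 ?lee_fin ?sqr_ge0// mule_ge0// inve_ge0 sqre_ge0.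
Qed.

Lemma measurable_directional_weight n (Omega : set 'rV[R]_n) q : open Omega ->
  measurable_fun setT
    (fun p : 'rV[R]_n * 'rV[R]_n => directional_weight Omega q p.1 p.2).
Proof.
move=> oO; apply: emeasurable_funD => //; apply: emeasurable_funM => //.
by apply: measurable_inve_sqr => //; [move=> *; exact: rho_ge0|exact: measurable_rho].
Qed.

Lemma integral_indicM d (T : measurableType d) (mu : {measure set T -> \bar R})
    (D : set T) (f : T -> \bar R) :
  \int[mu]_(x in D) f x = \int[mu]_x ((\1_D x)%:E * f x).
Proof.
rewrite integral_mkcond; apply: eq_integral => x _; rewrite patchE indicE.
by case: ifPn => _; rewrite ?mul1e ?mul0e.
Qed.

Lemma interval_le_max_chord n (Omega : set 'rV[R]_n) nu x (a b : R) :
  (a < b)%R -> `]a, b[ `<=` [set s | Omega (x + s *: nu)%R] ->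
  (b - a)%:E <= max_chord Omega nu x.
Proof.
move=> ab; pose S := [set s : R | Omega (x + s *: nu)%R]; rewrite -/S => abS.
have ct : `]a, b[%classic ((a + b) / 2)%R.
  by rewrite /= in_itv/=; apply/andP; split; lra.
apply: (@le_trans _ _ (lebesgue_measure (connected_component S ((a + b) / 2)%R))).
  have <- : lebesgue_measure (`]a, b[%classic : set R) = (b - a)%:E.
    by rewrite lebesgue_measure_itv/= lte_fin ab EFinB.
  apply: le_measure; rewrite ?inE//.
    apply: is_interval_measurable; apply/connected_intervalP.
    exact: component_connected.
  apply: connected_component_max => //; apply/connected_intervalP.
  exact: interval_is_interval.
by apply: ereal_sup_ubound; right; exists ((a + b) / 2)%R => //; exact: abS.
Qed.

(** The value q = 0, admissible for every D, gives the first term of the final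
    constant alone, and serves when the essential diameter is infinite. *)
Definition admissible (q D : R) := q = 0%R \/ (q * (D / 2) < lamb_constant)%R.

Section test.
Variables (n : nat) (Omega : set 'rV[R]_n) (phi : 'rV[R]_n -> R).
Hypotheses (oOmega : open Omega) (tphi : test_function Omega phi).

Lemma test_continuous : continuous phi.
Proof. by case: tphi => /(_ [::]) []. Qed.

Lemma test_derivable i x : derivable phi x (delta_mx 0%R i).
Proof. by case: tphi => /(_ [::]) []. Qed.

Lemma test_partial_continuous i : continuous (partial i phi).
Proof. by case: tphi => /(_ [:: i]) []. Qed.

Lemma test_is_derive x nu : is_derive x nu phi (dot nu (grad phi x)).
Proof.
by apply: is_derive_grad; [move=> *; exact: test_derivable|exact: test_partial_continuous].
Qed.

Lemma continuous_line (x nu : 'rV[R]_n) : continuous (fun s : R => x + s *: nu)%R.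
Proof.
by move=> s; apply: cvgD; [exact: cvg_cst|apply: cvgZr_tmp; exact: cvg_id].
Qed.

Lemma hardy_on_line x nu q D : enorm nu = 1%R -> (0 <= q)%R -> admissible q D ->
  (q = 0%R \/ max_chord Omega nu x <= D%:E) ->
  \int[lebesgue_measure]_(s in [set s | Omega (x + s *: nu)%R])
     ((phi (x + s *: nu)%R ^+ 2)%:E * directional_weight Omega q nu (x + s *: nu)%R) <=
  \int[lebesgue_measure]_(s in [set s | Omega (x + s *: nu)%R])
     (dot nu (grad phi (x + s *: nu)%R) ^+ 2)%:E.
Proof.
move=> nu1 q0 qD chord; set S := [set s | _].
under eq_integral do rewrite directional_weight_line.
case: (tphi) => _ cK KO; set K := closure _ in cK KO.
apply: (@hardy_line _ S [set s | K (x + s *: nu)%R] (fun s => phi (x + s *: nu)%R)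
  (fun s => dot nu (grad phi (x + s *: nu)%R)) q) => //.
- by apply: open_comp => // s _; exact: continuous_line.
- by apply: closed_comp => [s _|]; [exact: continuous_line|exact: closed_closure].
- by move=> s; exact: KO.
- have [M [_ KM]] := compact_bounded cK.
  have nu0 : (0 < `|nu|)%R.
    rewrite normr_gt0; apply/eqP => nuE; move: nu1; rewrite nuE /enorm big1 ?sqrtr0.
      by move=> /eqP; rewrite eq_sym oner_eq0.
    by move=> i _; rewrite mxE expr0n.
  exists ((`|M| + 1 + `|x|) / `|nu| + 1)%R => s Ks.
  rewrite ltr_pwDr// ler_pdivlMr// -normrZ.
  rewrite -(addrK x (s *: nu)%R) (addrC _ x) (le_trans (ler_normB _ _))//.
  rewrite lerD2r; apply: KM Ks.
  by rewrite (le_lt_trans (ler_norm _))// ltrDl.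
- move=> s nK; apply: contrapT => /eqP h; apply: nK.
  exact: subset_closure.
- move=> s; have d := test_is_derive (x + s *: nu)%R nu.
  have := is_derive_line (@ex_derive _ _ _ _ _ _ _ d).
  by rewrite (@derive_val _ _ _ _ _ _ _ d).
- have cp i : continuous (fun s : R => partial i phi (x + s *: nu)%R).
    move=> s; apply: (@continuous_comp _ _ _ (fun s : R => x + s *: nu)%R (partial i phi)).
      exact: continuous_line.
    exact: test_partial_continuous.
  move=> s; rewrite (_ : (fun _ => _) =
      (fun s => \sum_i nu 0%R i * partial i phi (x + s *: nu))%R).
    apply: cvg_big => [|i _]; first exact: add_continuous.
    apply: cvgM; first exact: cvg_cst.
    exact: cp.
  by apply/funext => r; rewrite dotE; apply: eq_bigr => i _; rewrite mxE.
- move=> a b ab abS; case: qD => [->|qD]; first by left.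
  case: chord => [->|chord]; first by left.
  right; apply: le_lt_trans qD; rewrite ler_wpM2l// ler_pM2r// -lee_fin.
  by apply: le_trans chord; exact: interval_le_max_chord.
Qed.

End test.

Definition energy_density n (Omega : set 'rV[R]_n) phi (nu x : 'rV[R]_n) : \bar R :=
  (\1_Omega x)%:E * (dot nu (grad phi x) ^+ 2)%:E.

Definition hardy_density n (Omega : set 'rV[R]_n) phi q (nu x : 'rV[R]_n) : \bar R :=
  (\1_Omega x)%:E * ((phi x ^+ 2)%:E * directional_weight Omega q nu x).

Section test_integral.
Variables (n : nat) (Omega : set 'rV[R]_n) (phi : 'rV[R]_n -> R).
Hypotheses (oOmega : open Omega) (tphi : test_function Omega phi).

Lemma measurable_dot_grad : measurable_fun setT
  (fun p : 'rV[R]_n * 'rV[R]_n => dot p.1 (grad phi p.2)).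
Proof.
under eq_fun do rewrite dotE; apply: measurable_sum => i.
apply: measurable_funM.
  exact: (measurableT_comp (measurable_coord i) measurable_fst).
under eq_fun do rewrite mxE.
apply: (@measurableT_comp _ _ _ _ _ _ (partial i phi)); last exact: measurable_snd.
by apply: measurable_continuous_rV; exact: test_partial_continuous tphi _.
Qed.

Lemma measurable_indic_open :
  measurable_fun setT (fun x : 'rV[R]_n => (\1_Omega x)%:E : \bar R).
Proof.
apply/measurable_EFinP; apply: measurable_indic; exact: measurable_open_rV.
Qed.

Lemma measurable_test_sqr : measurable_fun setT (fun x : 'rV[R]_n => (phi x ^+ 2)%:E).
Proof.
apply/measurable_EFinP; apply: measurable_funX; apply: measurable_continuous_rV.
exact: test_continuous tphi.
Qed.

Lemma measurable_energy_density : measurable_fun setT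
  (fun p : 'rV[R]_n * 'rV[R]_n => energy_density Omega phi p.1 p.2).
Proof.
apply: emeasurable_funM.
  exact: (measurableT_comp measurable_indic_open measurable_snd).
by apply/measurable_EFinP/measurable_funX; exact: measurable_dot_grad.
Qed.

Lemma energy_density_ge0 nu x : 0 <= energy_density Omega phi nu x.
Proof. by rewrite mule_ge0 ?lee_fin ?sqr_ge0. Qed.

Lemma measurable_hardy_density q : measurable_fun setT
  (fun p : 'rV[R]_n * 'rV[R]_n => hardy_density Omega phi q p.1 p.2).
Proof.
apply: emeasurable_funM.
  exact: (measurableT_comp measurable_indic_open measurable_snd).
apply: emeasurable_funM.
  exact: (measurableT_comp measurable_test_sqr measurable_snd).
exact: measurable_directional_weight.
Qed.

Lemma hardy_density_ge0 q nu x : 0 <= hardy_density Omega phi q nu x.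
Proof. by rewrite !mule_ge0 ?directional_weight_ge0 ?lee_fin ?sqr_ge0. Qed.

End test_integral.

(** Tonelli's theorem along the lines of direction nu; almost every one of them
    has chords of length at most D, so [hardy_on_line] applies to it. *)
Lemma hardy_in_direction m (Omega : set 'rV[R]_m.+1) phi (nu : 'rV[R]_m.+1) q D :
  open Omega -> test_function Omega phi ->
  enorm nu = 1%R -> (0 <= q)%R -> admissible q D ->
  (q = 0%R \/ {ae lebesgue_rV m, forall y,
      max_chord Omega nu (y *m hyperplane_frame nu)%R <= D%:E}) ->
  \int[lebesgue_rV m.+1]_x hardy_density Omega phi q nu x <=
  \int[lebesgue_rV m.+1]_x energy_density Omega phi nu x.
Proof.
move=> oO tphi nu1 q0 qD chord.
pose F := hyperplane_frame nu.
have mH := measurableT_comp (measurable_hardy_density oO tphi q) (pair1_measurable nu).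
have mE := measurableT_comp (measurable_energy_density oO tphi) (pair1_measurable nu).
rewrite [leLHS](integral_lines nu1 mH (hardy_density_ge0 _ _ _ _)).
rewrite [leRHS](integral_lines nu1 mE (energy_density_ge0 _ _ _)).
have mline : measurable_fun setT (fun p : measurableTypeR R * 'rV[R]_m =>
    (p.2 *m F + (p.1 : R) *: nu)%R).
  apply: measurable_rVD.
    exact: (measurableT_comp (measurable_mulmx F) measurable_snd).
  by apply: measurable_rVZ => //; exact: measurable_fst.
apply: ae_ge0_le_integral => //.
- by move=> y _; apply: integral_ge0 => s _; exact: hardy_density_ge0.
- exact: (measurable_fun_fubini_tonelli_G (fun p : measurableTypeR R * 'rV[R]_m =>
    hardy_density Omega phi q nu
    (p.2 *m F + (p.1 : R) *: nu)%R) (measurableT_comp mH mline)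
    (fun p => hardy_density_ge0 _ _ _ _ _)).
- by move=> y _; apply: integral_ge0 => s _; exact: energy_density_ge0.
- exact: (measurable_fun_fubini_tonelli_G (fun p : measurableTypeR R * 'rV[R]_m =>
    energy_density Omega phi nu
    (p.2 *m F + (p.1 : R) *: nu)%R) (measurableT_comp mE mline)
    (fun p => energy_density_ge0 _ _ _ _)).
have line y : (q = 0%R \/ max_chord Omega nu (y *m F)%R <= D%:E) ->
  \int[lebesgue_measure]_s hardy_density Omega phi q nu (y *m F + s *: nu)%R <=
  \int[lebesgue_measure]_s energy_density Omega phi nu (y *m F + s *: nu)%R.
  move=> cy; have := hardy_on_line oO tphi nu1 q0 qD cy.
  by rewrite [in leLHS]integral_indicM [in leRHS]integral_indicM.
case: chord => [q00|].
  by apply: nearW => y _; apply: line; left.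
by apply: filterS => y cy _; apply: line; right.
Qed.

(** For x in Omega, mu^2 >= n d(x)^2, and d(x)^-2 is n times the mean of
    rho_nu(x)^-2. The infinite values are consistent: mu = 0 makes both sides
    infinite, mu = +oo makes the left one 0. *)
Lemma inve_quasi_inradius_le n (Omega : set 'rV[R]_n) x : (0 < n)%N -> open Omega -> Omega x ->
  n%:R%:E / (4%:E * quasi_inradius Omega ^+ 2) <=
  4^-1%:E * (n%:R%:E * \int[@sphere_measure R n]_nu (rho Omega nu x ^+ 2)^-1).
Proof.
move=> n0 oO Ox; set I := \int[_]_nu _.
have mI : measurable_fun setT (fun nu : 'rV[R]_n => (rho Omega nu x ^+ 2)^-1).
  apply: measurable_inve_sqr => // [nu _|]; first exact: rho_ge0.
  exact: (measurableT_comp (measurable_rho oO) (pair2_measurable x)).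
have I0 nu : 0 <= (rho Omega nu x ^+ 2)^-1 by rewrite inve_ge0 sqre_ge0.
set J := n%:R%:E * I; have J0 : 0 <= J by rewrite mule_ge0 ?lee_fin// integral_ge0.
pose s := ereal_sup [set mean_distance2 Omega x | x in Omega].
have ds : (sqrte J)^-1 <= s.
  apply: ereal_sup_ubound; exists x => //; rewrite /mean_distance2.
  by rewrite (@integral_sphere R n (fun nu => (rho Omega nu x ^+ 2)^-1)).
have s0 : 0 <= s by apply: le_trans ds; rewrite inve_ge0 sqrte_ge0.
have sJ : (s^-1) ^+ 2 <= J.
  rewrite -[leRHS]sqr_sqrte// lee_sqr ?inve_ge0 ?sqrte_ge0//.
  by rewrite -[leRHS]inveK lee_pV2 ?inE ?inve_ge0 ?sqrte_ge0.
apply: (@le_trans _ _ (4^-1%:E * (s^-1) ^+ 2)); last first.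
  by rewrite lee_wpmul2l ?lee_fin ?invr_ge0.
rewrite /quasi_inradius -/s; move: s s0 {ds sJ} => s s0.
have nR0 : (0 < n%:R :> R)%R by rewrite ltr0n.
case: s s0 => [r||]// r0.
- have -> : ((Num.sqrt n%:R)%:E * r%:E) ^+ 2 = (n%:R * r ^+ 2)%:E.
    by rewrite -EFinM expe2 -EFinM -expr2 exprMn sqr_sqrtr// ltW.
  rewrite -EFinM.
  have [->|rN0] := eqVneq r 0%R.
    have -> : (4 * (n%:R * 0 ^+ 2) = 0 :> R)%R by rewrite expr0n/= !mulr0.
    by rewrite !inve0 expe2 mulyy [leRHS]gt0_muley ?lte_fin ?invr_gt0// leey.
  rewrite !inver !(negbTE rN0) mulf_eq0 mulf_eq0 !pnatr_eq0 (gtn_eqF n0).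
  rewrite expf_eq0 (negbTE rN0)/=.
  rewrite ?expe2 -!EFinM lee_fin.
  rewrite le_eqVlt; apply/orP; left; apply/eqP; field.
  by rewrite rN0 gt_eqF.
- rewrite gt0_muley ?lte_fin ?sqrtr_gt0// expe2 mulyy gt0_muley ?lte_fin// invey mule0.
  by rewrite ?mul0e mule_ge0 ?lee_fin ?invr_ge0 ?sqre_ge0.
Qed.

Lemma weight_mean_ge n (Omega : set 'rV[R]_n) q x : (0 < n)%N -> open Omega -> Omega x ->
  n%:R%:E / (4%:E * quasi_inradius Omega ^+ 2) + (n%:R * q ^+ 2)%:E <=
  n%:R%:E * \int[@sphere_measure R n]_nu directional_weight Omega q nu x.
Proof.
move=> n0 oO Ox.
have mI : measurable_fun setT (fun nu : 'rV[R]_n => (rho Omega nu x ^+ 2)^-1).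
  apply: measurable_inve_sqr => // [nu _|]; first exact: rho_ge0.
  exact: (measurableT_comp (measurable_rho oO) (pair2_measurable x)).
have I0 nu : 0 <= (rho Omega nu x ^+ 2)^-1 by rewrite inve_ge0 sqre_ge0.
have m4 : measurable_fun setT (fun nu : 'rV[R]_n => 4^-1%:E * (rho Omega nu x ^+ 2)^-1).
  exact: emeasurable_funM.
rewrite /directional_weight ge0_integralD//; last 2 first.
- by move=> nu _; rewrite mule_ge0.
- by move=> nu _; rewrite lee_fin sqr_ge0.
have -> : \int[@sphere_measure R n]_nu (q ^+ 2)%:E = (q ^+ 2)%:E.
  rewrite integral_cst// [X in _ * X](_ : _ = 1) ?mule1//; exact: sphere_measureT.
rewrite ge0_integralZl//.
rewrite ge0_muleDr ?lee_fin ?sqr_ge0//; last first.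
  by rewrite mule_ge0 ?lee_fin// integral_ge0.
rewrite (muleCA n%:R%:E (4^-1%:E)) -(EFinM n%:R); apply: leeD => //.
exact: inve_quasi_inradius_le.
Qed.

(** The inequality in direction nu, averaged over the sphere and multiplied by n.
    Both averages are computed after exchanging the integrals over the sphere and
    over Omega. *)
Lemma hardy_test m (Omega : set 'rV[R]_m.+1) phi q D :
  open Omega -> test_function Omega phi -> (0 <= q)%R -> admissible q D ->
  (q = 0%R \/ essential_diameter Omega <= D%:E) ->
  (m.+1%:R%:E / (4%:E * quasi_inradius Omega ^+ 2) + (m.+1%:R * q ^+ 2)%:E) *
    \int[lebesgue_rV m.+1]_(x in Omega) (phi x ^+ 2)%:E <=
  \int[lebesgue_rV m.+1]_(x in Omega) (enorm (grad phi x) ^+ 2)%:E.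
Proof.
move=> oO tphi q0 qD diam.
have dir : \forall nu \ae (@sphere_measure R m.+1), sphere nu ->
    \int[lebesgue_rV m.+1]_x hardy_density Omega phi q nu x <=
    \int[lebesgue_rV m.+1]_x energy_density Omega phi nu x.
  case: diam => [q00|/ess_supP].
    by apply: nearW => nu nu1; apply: (@hardy_in_direction _ _ _ _ q D) => //; left.
  apply: filterS => nu /ess_supP chord nu1.
  by apply: (@hardy_in_direction _ _ _ _ q D) => //; right.
have n0 : (0 < m.+1)%N by [].
move: (m.+1) n0 Omega phi oO tphi {diam} dir => n n0 Omega phi oO tphi dir.
set lam := lebesgue_rV n; set sigma := @sphere_measure R n.
set C := _ + _.
have C0 : 0 <= C.
  apply: adde_ge0; last by rewrite lee_fin mulr_ge0// sqr_ge0.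
  by rewrite mule_ge0 ?lee_fin// inve_ge0 mule_ge0// sqre_ge0.
have mE := measurable_energy_density oO tphi.
have mH := measurable_hardy_density oO tphi q.
have mO := measurable_open_rV oO.
have mphi := measurable_test_sqr tphi.
have energyE : \int[lam]_(x in Omega) (enorm (grad phi x) ^+ 2)%:E =
    n%:R%:E * \int[sigma]_nu \int[lam]_x energy_density Omega phi nu x.
  rewrite (fubini_tonelli (fun p => energy_density Omega phi p.1 p.2))//; last first.
    by move=> p; exact: energy_density_ge0.
  rewrite -ge0_integralZl//; last 2 first.
  - exact: (measurable_fun_fubini_tonelli_G (fun p => energy_density Omega phi p.1 p.2)
      mE (fun p => energy_density_ge0 _ _ _ _)).
  - by move=> x _; apply: integral_ge0 => nu _; exact: energy_density_ge0.
  rewrite [LHS]integral_indicM; apply: eq_integral => x _.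
  rewrite /energy_density /= ge0_integralZl//; last 2 first.
  - apply/measurable_EFinP; apply: measurable_funX; exact: measurable_dot.
  - by move=> nu _; rewrite lee_fin sqr_ge0.
  by rewrite muleCA integral_sphere_dot.
have hardyE : n%:R%:E * \int[sigma]_nu \int[lam]_x hardy_density Omega phi q nu x =
    \int[lam]_(x in Omega) ((phi x ^+ 2)%:E *
      (n%:R%:E * \int[sigma]_nu directional_weight Omega q nu x)).
  rewrite (fubini_tonelli (fun p => hardy_density Omega phi q p.1 p.2))//; last first.
    by move=> p; exact: hardy_density_ge0.
  rewrite -ge0_integralZl//; last 2 first.
  - exact: (measurable_fun_fubini_tonelli_G (fun p => hardy_density Omega phi q p.1 p.2)
      mH (fun p => hardy_density_ge0 _ _ _ _ _)).
  - by move=> x _; apply: integral_ge0 => nu _; exact: hardy_density_ge0.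
  rewrite [RHS]integral_indicM; apply: eq_integral => x _.
  have mW : measurable_fun setT (fun nu => directional_weight Omega q nu x).
    exact: (measurableT_comp (measurable_directional_weight q oO) (pair2_measurable x)).
  rewrite /hardy_density /= ge0_integralZl//; last 2 first.
  - by apply: emeasurable_funM.
  - by move=> nu _; rewrite mule_ge0 ?directional_weight_ge0// lee_fin sqr_ge0.
  rewrite ge0_integralZl//; last 2 first.
  - by move=> nu _; rewrite directional_weight_ge0.
  - by rewrite lee_fin sqr_ge0.
  by rewrite [LHS]muleCA; congr (_ * _); rewrite muleCA.
rewrite energyE; apply: (@le_trans _ _
    (n%:R%:E * \int[sigma]_nu \int[lam]_x hardy_density Omega phi q nu x)).
  rewrite hardyE -ge0_integralZl//; last 2 first.
  - exact: measurable_funTS.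
  - by move=> x _; rewrite lee_fin sqr_ge0.
  apply: ge0_le_integral => //.
  - by move=> x _; rewrite mule_ge0// lee_fin sqr_ge0.
  - by apply: emeasurable_funM => //; exact: measurable_funTS.
  - apply: emeasurable_funM; first exact: measurable_funTS.
    apply: emeasurable_funM => //; apply: measurable_funTS.
    exact: (measurable_fun_fubini_tonelli_G (m1 := sigma)
      (fun p => directional_weight Omega q p.1 p.2)
      (measurable_directional_weight q oO) (fun p => directional_weight_ge0 _ _ _ _)).
  - move=> x Ox; rewrite muleC lee_wpmul2l ?lee_fin ?sqr_ge0//.
    exact: weight_mean_ge.
rewrite lee_wpmul2l ?lee_fin//.
have mHx := measurable_fun_fubini_tonelli_F (m2 := lam)
  (fun p => hardy_density Omega phi q p.1 p.2) mH (fun p => hardy_density_ge0 _ _ _ _ _).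
have mEx := measurable_fun_fubini_tonelli_F (m2 := lam)
  (fun p => energy_density Omega phi p.1 p.2) mE (fun p => energy_density_ge0 _ _ _ _).
have Hx nu : 0 <= \int[lam]_x hardy_density Omega phi q nu x.
  by apply: integral_ge0 => x _; exact: hardy_density_ge0.
have Ex nu : 0 <= \int[lam]_x energy_density Omega phi nu x.
  by apply: integral_ge0 => x _; exact: energy_density_ge0.
rewrite -(integral_sphere mHx Hx) -(integral_sphere mEx Ex).
apply: ae_ge0_le_integral => //.
- exact: measurable_sphere.
- by move=> nu _; exact: Hx.
- exact: measurable_funTS mHx.
- by move=> nu _; exact: Ex.
- exact: measurable_funTS mEx.
Qed.

End directional_hardy.

(** * From test functions to H^1_0 *)

Section density.
Context {R : realType}.
Local Open Scope ereal_scope.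

Lemma integral_le_combination d (T : measurableType d)
    (mu : {measure set T -> \bar R}) (D : set T) (f g h : T -> R) (a b : R) :
  measurable D -> (0 <= a)%R -> (0 <= b)%R ->
  measurable_fun D f -> measurable_fun D g -> measurable_fun D h ->
  (forall x, 0 <= f x)%R -> (forall x, 0 <= g x)%R -> (forall x, 0 <= h x)%R ->
  (forall x, f x <= a * g x + b * h x)%R ->
  \int[mu]_(x in D) (f x)%:E <=
  a%:E * \int[mu]_(x in D) (g x)%:E + b%:E * \int[mu]_(x in D) (h x)%:E.
Proof.
move=> mD a0 b0 mf mg mh f0 g0 h0 fgh.
have mgE : measurable_fun D (fun x => (g x)%:E) by exact/measurable_EFinP.
have mhE : measurable_fun D (fun x => (h x)%:E) by exact/measurable_EFinP.
rewrite -!ge0_integralZl ?lee_fin//; [|by move=> x _; rewrite lee_fin..].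
rewrite -ge0_integralD//; last 4 first.
- by move=> x _; rewrite mule_ge0// lee_fin.
- exact: emeasurable_funM.
- by move=> x _; rewrite mule_ge0// lee_fin.
- exact: emeasurable_funM.
apply: ge0_le_integral => //.
- by move=> x _; rewrite lee_fin.
- exact/measurable_EFinP.
- by apply: emeasurable_funD; exact: emeasurable_funM.
- by move=> x _; rewrite -!EFinM -EFinD lee_fin.
Qed.

(** Young's inequality, in the form of a perturbation estimate for squares. *)
Lemma sqr_perturb (d s t : R) : (0 < d)%R ->
  (s ^+ 2 <= (1 + d) * t ^+ 2 + (1 + d^-1) * (s - t) ^+ 2)%R.
Proof.
move=> d0; rewrite -subr_ge0.
rewrite (_ : (_ - _)%R = ((d * t - (s - t)) ^+ 2 / d)%R).
  by rewrite divr_ge0 ?sqr_ge0// ltW.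
by field; rewrite gt_eqF.
Qed.

Lemma sqr_enormE n (x : 'rV[R]_n) : (enorm x ^+ 2 = \sum_i x 0 i ^+ 2)%R.
Proof. by rewrite sqr_enorm dotE; apply: eq_bigr => i _; rewrite expr2. Qed.

Lemma sqr_enorm_perturb n (d : R) (x y : 'rV[R]_n) : (0 < d)%R ->
  (enorm x ^+ 2 <= (1 + d) * enorm y ^+ 2 + (1 + d^-1) * enorm (y - x) ^+ 2)%R.
Proof.
move=> d0; rewrite !sqr_enormE !mulr_sumr -big_split/=; apply: ler_sum => i _.
by rewrite !mxE -[X in (_ + _ * X)%R]sqrrN opprB; exact: sqr_perturb.
Qed.

Lemma measurable_sqr_enorm n (D : set 'rV[R]_n) (f : 'rV[R]_n -> 'rV[R]_n) :
  (forall i, measurable_fun D (fun x => f x 0%R i)) ->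
  measurable_fun D (fun x => enorm (f x) ^+ 2)%R.
Proof.
move=> mf; under eq_fun do rewrite sqr_enormE.
by apply: measurable_sum => i; apply: measurable_funX; exact: mf.
Qed.

(** Two perturbation estimates with parameter d, for u around phi and for grad phi
    around Du, bound the left-hand side by (1 + d)^2 times the right-hand side
    plus a multiple, depending on d, of the squared H^1 distance of phi from u. *)
Lemma in_H1_0_extend n (Omega : set 'rV[R]_n) (c : R) u Du :
  open Omega -> (0 <= c)%R ->
  (forall phi, test_function Omega phi ->
    c%:E * \int[lebesgue_rV n]_(x in Omega) (phi x ^+ 2)%:E <=
    \int[lebesgue_rV n]_(x in Omega) (enorm (grad phi x) ^+ 2)%:E) ->
  in_H1_0 Omega u Du ->
  c%:E * \int[lebesgue_rV n]_(x in Omega) (u x ^+ 2)%:E <=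
  \int[lebesgue_rV n]_(x in Omega) (enorm (Du x) ^+ 2)%:E.
Proof.
move=> oO c0 test [[[mu _] mDu _] dense].
have mO := measurable_open_rV oO.
set lam := lebesgue_rV n; set J := leRHS.
have J0 : 0 <= J by apply: integral_ge0 => x _; rewrite lee_fin sqr_ge0.
case JE : J J0 => [j||]// => [j0|_]; last by rewrite leey.
rewrite lee_fin in j0.
apply/lee_addgt0Pr => e e0.
(* (1 + d)^2 j <= j + e/2, where j is the right-hand side and d <= 1 *)
pose d : R := Num.min 1%R (e / (6 * (j + 1)))%R.
have j1 : (0 < 6 * (j + 1))%R by rewrite mulr_gt0// ltr_wpDl.
have d0 : (0 < d)%R by rewrite lt_min ltr01 divr_gt0.
have d1 : (d <= 1)%R by rewrite ge_min lexx.
have dj : (6 * d * (j + 1) <= e)%R.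
  by rewrite mulrAC -ler_pdivlMl// mulrC ge_min lexx orbT.
pose k : R := (1 + d^-1)%R.
have k0 : (0 < k)%R by rewrite ltr_pwDl// invr_ge0 ltW.
(* coefficient of the H^1 distance in the final bound *)
pose K : R := ((1 + d) * k + c * k)%R.
have K0 : (0 < K)%R.
  by apply: ltr_pwDl; [rewrite mulr_gt0// addr_gt0|rewrite mulr_ge0// ltW].
have e2K : (0 < e / (2 * K))%R by rewrite divr_gt0// mulr_gt0.
have [phi tphi dist] := dense _ e2K.
have mphi : measurable_fun Omega phi.
  by apply: measurable_funTS; apply: measurable_continuous_rV; exact: test_continuous tphi.
have mgrad i : measurable_fun Omega (fun x => grad phi x 0%R i).
  under eq_fun do rewrite mxE.
  apply: measurable_funTS; apply: measurable_continuous_rV.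
  exact: test_partial_continuous tphi _.
have mDui i : measurable_fun Omega (fun x => Du x 0%R i) by case: (mDu i).
set d1' := \int[lam]_(x in Omega) ((u x - phi x) ^+ 2)%:E.
set d2' := \int[lam]_(x in Omega) (enorm (Du x - grad phi x) ^+ 2)%:E.
have {dist} dist : d1' + d2' < (e / (2 * K))%:E by exact: dist.
have d10 : 0 <= d1' by apply: integral_ge0 => x _; rewrite lee_fin sqr_ge0.
have d20 : 0 <= d2' by apply: integral_ge0 => x _; rewrite lee_fin sqr_ge0.
set A := \int[lam]_(x in Omega) (phi x ^+ 2)%:E.
set G := \int[lam]_(x in Omega) (enorm (grad phi x) ^+ 2)%:E.
have A0 : 0 <= A by apply: integral_ge0 => x _; rewrite lee_fin sqr_ge0.
have dd : (0 <= 1 + d)%R by rewrite addr_ge0// ltW.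
have h1 : \int[lam]_(x in Omega) (u x ^+ 2)%:E <= (1 + d)%:E * A + k%:E * d1'.
  apply: integral_le_combination => //; try exact: ltW;
    try by move=> x; rewrite sqr_ge0.
  - exact: measurable_funX.
  - exact: measurable_funX.
  - by apply: measurable_funX; exact: measurable_funB.
  - by move=> x; exact: sqr_perturb.
have h2 : G <= (1 + d)%:E * J + k%:E * d2'.
  apply: integral_le_combination => //; try exact: ltW;
    try by move=> x; rewrite sqr_ge0.
  - exact: measurable_sqr_enorm.
  - exact: measurable_sqr_enorm.
  - apply: measurable_sqr_enorm => i.
    rewrite (_ : (fun _ => _) = (fun x => Du x 0%R i - grad phi x 0%R i)%R).
      exact: measurable_funB.
    by apply/funext => x; rewrite [LHS]mxE [X in (_ + X)%R]mxE.
  - by move=> x; exact: sqr_enorm_perturb.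
have hT : c%:E * A <= G by exact: test.
have d1fin : d1' = (fine d1')%:E.
  rewrite fineK// ge0_fin_numE// (le_lt_trans _ (lt_trans dist (ltry _)))//.
  by rewrite leeDl.
have d2fin : d2' = (fine d2')%:E.
  rewrite fineK// ge0_fin_numE// (le_lt_trans _ (lt_trans dist (ltry _)))//.
  by rewrite leeDr.
apply: (@le_trans _ _ (c%:E * ((1 + d)%:E * A + k%:E * d1'))).
  by rewrite lee_wpmul2l// lee_fin.
rewrite ge0_muleDr; last 2 first.
- by rewrite mule_ge0// lee_fin addr_ge0// ltW.
- by rewrite mule_ge0// lee_fin ltW.
rewrite muleCA.
apply: (@le_trans _ _ ((1 + d)%:E * ((1 + d)%:E * J + k%:E * d2') + c%:E * (k%:E * d1'))).
  by rewrite leeD2r// lee_wpmul2l ?lee_fin ?addr_ge0 ?(ltW d0)// (le_trans hT).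
move: (fine d1') (fine d2') d1fin d2fin => a b d1a d2b.
move: dist d10 d20; rewrite d1a d2b JE.
rewrite -?EFinM -?EFinD -?EFinM -?EFinD -?EFinM -?EFinD lte_fin !lee_fin => ab a0 b0.
have aE : (a <= e / (2 * K))%R by lra.
have bE : (b <= e / (2 * K))%R by lra.
have KE : (K * (e / (2 * K)) = e / 2)%R by field; rewrite gt_eqF.
have : ((1 + d) * k * b + c * k * a <= e / 2)%R.
  move: (e / (2 * K))%R aE bE KE => s aE bE <-.
  rewrite /K [leRHS]mulrDl; apply: lerD; apply: ler_wpM2l => //.
    by rewrite mulr_ge0//; exact: ltW.
  by rewrite mulr_ge0//; exact: ltW.
have dj2 : ((1 + d) * (1 + d) * j <= j + e / 2)%R.
  have : (d * d * j <= d * j)%R by rewrite ler_wpM2r// ler_piMl// ltW.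
  by move: dj; nra.
by move: dj2; nra.
Qed.

End density.

(** * The quadratic form inequality *)

Section quadratic_form.
Context {R : realType}.
Local Open Scope ereal_scope.

Lemma lamb_constant_ge0 : (0 <= lamb_constant :> R)%R.
Proof.
rewrite /lamb_constant; set S := [set r | _].
have [->|/set0P S0] := eqVneq S set0; first by rewrite inf0.
by apply: lb_le_inf => // r [/ltW].
Qed.

(** Real constants suffice: when C = +oo, they force I = 0 or J = +oo. *)
Lemma mule_le_of_lt (C I J : \bar R) : 0 <= I -> 0 <= J ->
  (forall c : R, (0 <= c)%R -> c%:E < C -> c%:E * I <= J) -> C * I <= J.
Proof.
move=> I0 J0 h.
have [C0|C0] := leP C 0; first by rewrite (le_trans _ J0)// mule_le0_ge0.
move: I0; rewrite le_eqVlt => /predU1P[<-|I0]; first by rewrite mule0.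
case: J J0 h => [j||]// J0 h; last by rewrite leey.
rewrite lee_fin in J0.
case: I I0 h => [i||]// I0 h; last first.
  have [r r0 rC] : exists2 r : R, (0 < r)%R & r%:E < C.
    case: C C0 {h} => [c||]// C0; last by exists 1%R => //; rewrite ltry.
    by rewrite lte_fin in C0; exists (c / 2)%R; rewrite ?lte_fin; lra.
  by have := h r (ltW r0) rC; rewrite gt0_muley ?lte_fin.
rewrite lte_fin in I0.
case: C C0 h => [c||]// C0 h.
  rewrite -EFinM lee_fin leNgt; apply/negP => jci.
  rewrite lte_fin in C0; rewrite -ltr_pdivrMr// in jci.
  have ji0 : (0 <= j / i)%R by rewrite divr_ge0// ltW.
  have := h ((j / i + c) / 2)%R.
  rewrite lte_fin -EFinM lee_fin -ler_pdivlMr// => /(_ ltac:(lra) ltac:(lra)); lra.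
have := h ((j + 1) / i)%R; rewrite divr_ge0 ?addr_ge0 ?(ltW I0)// ltry => /(_ isT isT).
by rewrite -EFinM divfK ?gt_eqF// lee_fin => jj; exfalso; lra.
Qed.

Lemma essential_diameter_ge0 m (Omega : set 'rV[R]_m.+1) :
  0 <= essential_diameter Omega.
Proof.
apply: ess_sup_gee.
  by rewrite [X in _ < X]sphere_measureT// lte01.
apply: nearW => nu; apply: ess_sup_gee.
  apply: (@lt_le_trans _ _ (lebesgue_rV m (@rV_box R m 0 1))).
    by rewrite lebesgue_rV_box// subr0 expr1n lte_fin.
  by apply: le_measure; rewrite ?inE//; exact: measurable_rV_box.
by apply: nearW => y; apply: ereal_sup_ubound; left.
Qed.

(** Every nonnegative constant below the second term of the theorem is n q^2 for an
    admissible q. *)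
Lemma admissible_frequency n (d : \bar R) (t : R) : (0 < n)%N -> 0 <= d -> (0 <= t)%R ->
  t%:E < (4 * n%:R * lamb_constant ^+ 2)%R%:E / d ^+ 2 ->
  exists q D : R, [/\ (0 <= q)%R, admissible q D, q = 0%R \/ d <= D%:E &
    t = (n%:R * q ^+ 2)%R].
Proof.
move=> n0 d0 t0 td.
have nR0 : (0 < n%:R :> R)%R by rewrite ltr0n.
move: t0; rewrite le_eqVlt => /predU1P[<-|t0].
  by exists 0%R, 0%R; split => //; [left|left|rewrite expr0n mulr0].
pose q := Num.sqrt (t / n%:R)%R.
have q0 : (0 < q)%R by rewrite sqrtr_gt0 divr_gt0.
have qE : (n%:R * q ^+ 2 = t)%R.
  by rewrite sqr_sqrtr ?divr_ge0 ?ltW//; field; rewrite gt_eqF.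
have l0 : (0 < lamb_constant :> R)%R.
  rewrite lt_neqAle lamb_constant_ge0 andbT; apply/eqP => l0.
  by move: td; rewrite -l0 expr0n/= mulr0 mul0e lte_fin ltNge ltW.
case: d d0 td => [r||]// d0 td; last first.
  by move: td; rewrite expe2 mulyy invey mule0 lte_fin ltNge ltW.
rewrite lee_fin in d0; move: d0; rewrite le_eqVlt => /predU1P[r0|r0].
  (* d = 0: the upper bound on the diameter can be chosen as small as q needs *)
  exists q, (lamb_constant / q)%R; split => //; first exact: ltW.
    right; rewrite (_ : (q * _)%R = (lamb_constant / 2)%R); last by field; rewrite gt_eqF.
    by rewrite ltr_pdivrMr// ltr_pMr// ltr1n.
  by right; rewrite -r0 lee_fin divr_ge0// ltW.
exists q, r; split => //; [exact: ltW|right|by right].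
move: td; rewrite -EFin_expe inver expf_eq0/= (gt_eqF r0) -EFinM lte_fin -qE => td.
have {}td : (q ^+ 2 < (2 * lamb_constant / r) ^+ 2)%R.
  rewrite -(ltr_pM2l nR0) (lt_le_trans td)// le_eqVlt; apply/orP; left; apply/eqP.
  by field; rewrite gt_eqF.
have {}td : (q < 2 * lamb_constant / r)%R.
  by rewrite -(@ltr_pXn2r _ 2) ?nnegrE ?divr_ge0 ?mulr_ge0 ?ltW.
by rewrite mulrA ltr_pdivrMr// (mulrC lamb_constant) -ltr_pdivlMr.
Qed.

End quadratic_form.

Local Open Scope ereal_scope.

Theorem theorem3 (R : realType) (N : nat) (hN : (2 <= N)%N)
    (Omega : set 'rV[R]_N) (hOmega : domain Omega) (hproper : Omega <> setT)
    (u : 'rV[R]_N -> R) (Du : 'rV[R]_N -> 'rV[R]_N) (hu : in_H1_0 Omega u Du) :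
  (N%:R%:E / (4%:E * quasi_inradius Omega ^+ 2) +
   (4 * N%:R * lamb_constant ^+ 2)%R%:E / essential_diameter Omega ^+ 2) *
    (\int[lebesgue_rV N]_(x in Omega) (u x ^+ 2)%R%:E)
  <= \int[lebesgue_rV N]_(x in Omega) (enorm (Du x) ^+ 2)%R%:E.
Proof.
case: N hN Omega hOmega hproper u Du hu => // m _ Omega [oO _ _] _ u Du hu.
set A := _ / _; set E := _ / _ ^+ 2.
have A0 : 0 <= A.
  by rewrite mule_ge0 ?lee_fin// inve_ge0 mule_ge0// sqre_ge0.
apply: mule_le_of_lt => [||c c0 cAE].
- by apply: integral_ge0 => x _; rewrite lee_fin sqr_ge0.
- by apply: integral_ge0 => x _; rewrite lee_fin sqr_ge0.
apply: (in_H1_0_extend oO c0 _ hu) => phi tphi.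
have I0 : 0 <= \int[lebesgue_rV m.+1]_(x in Omega) (phi x ^+ 2)%:E.
  by apply: integral_ge0 => x _; rewrite lee_fin sqr_ge0.
have [cA|Ac] := leP c%:E A.
  (* here q = 0 is enough, and A may be infinite *)
  apply: le_trans (@hardy_test _ _ _ _ 0%R 0%R oO tphi (lexx _)
    (or_introl erefl) (or_introl erefl)).
  by rewrite lee_wpmul2r// expr0n mulr0 adde0.
case AE : A A0 Ac cAE => [a||]// A0 Ac cAE.
have t0 : (0 <= c - a)%R by rewrite subr_ge0 ltW// -lte_fin.
have tE : (c - a)%:E < E by rewrite EFinB lteBlDr// addeC.
have [q [D [q0 qD dD qE]]] :=
  admissible_frequency (ltn0Sn m) (essential_diameter_ge0 Omega) t0 tE.
apply: le_trans (hardy_test oO tphi q0 qD dD).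
by rewrite -/A AE -qE -EFinD addrC subrK.
Qed.
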